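(* Let $k,n\in\mathbb{N}$ and let $a=(a_1,\dots,a_k),\ b=(b_1,\dots,b_k)\in\mathcal{M}_n^k$ be $k$-tuples of self-adjoint matrices. The following are equivalent: (1) $a\prec b$; (2) there is a trace-preserving unital completely positive map $\Phi:\mathcal{M}_n\to\mathcal{M}_n$ such that $\Phi(b_i)=a_i$ for all $1\le i\le k$.
   Context: Conventions. Indices $m,n,p\le\infty$ range over $\{1,2,\dots\}\cup\{\infty\}$. For each $n\le\infty$ fix a complex Hilbert space $H_n$ of dimension $n$ ($H_\infty$ of countably infinite dimension). $\mathcal{M}_{m,n}$ is the space of bounded operators $H_n\to H_m$ with the weak* topology (the norm topology if $m,n<\infty$); $\mathcal{M}_n=\mathcal{M}_{n,n}$ with identity $1_n$; $\mathcal{M}=\sqcup_{n\le\infty}\mathcal{M}_n$. $\mathcal{M}_p(\mathcal{M}_n)$ is identified with the bounded operators on $H_p\otimes H_n$, and $\mathcal{M}_p(\mathcal{M})=\sqcup_n\mathcal{M}_p(\mathcal{M}_n)$. The subscript sa denotes self-adjoint elements, the superscript $+$ positive elements, and $\alpha\ge\beta$ means $\alpha-\beta$ is positive. $\mathcal{M}_n^k$ has the product topology, and for $x=(x_1,\dots,x_k)\in\mathcal{M}_n^k$, $\alpha x\beta=(\alpha x_1\beta,\dots,\alpha x_k\beta)$. For $n<\infty$, $\mathrm{tr}_n:\mathcal{M}_n\to\mathbb{C}$ is the trace normalized so that $\mathrm{tr}_n(1_n)=1$. Closed nc $k$-ball. For $r>0$, the closed nc $k$-ball of radius $r$ is the graded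 set $K=\sqcup_{n\le\infty}K_n$ with $K_n=\{x=(x_1,\dots,x_k)\in\mathcal{M}_n^k:\sum_{i=1}^k x_ix_i^*\le r^2 1_n\}$. Multivalued nc functions. Let $K$ be a closed nc $k$-ball and $p\le\infty$. A multivalued nc function $F:K\to\mathcal{M}_p(\mathcal{M})$ assigns to every $n\le\infty$ and $x\in K_n$ a nonempty set $F(x)\subseteq\mathcal{M}_p(\mathcal{M}_n)_{\mathrm{sa}}$ such that $F(\alpha^*x\alpha)=(1_p\otimes\alpha^* )F(x)(1_p\otimes\alpha)$ for every unitary $\alpha\in\mathcal{M}_n$, and $F(x)=F(x)+\mathcal{M}_p(\mathcal{M}_n)^+$. It is bounded if there is $\lambda>0$ such that for every $x\in K$ and $\beta\in F(x)$ there is $\alpha\in F(x)$ with $\alpha\le\beta$ and $\|\alpha\|\le\lambda$. Its graph is $\mathrm{Graph}(F)=\sqcup_n\mathrm{Graph}_n(F)$ with $\mathrm{Graph}_n(F)=\{(x,T):x\in K_n,\ T\in F(x)\}\subseteq K_n\times\mathcal{M}_p(\mathcal{M}_n)$. $F$ is convex if $\mathrm{Graph}(F)$ is an nc convex set, i.e. for every $n\le\infty$, every bounded sequence $(x_i,T_i)\in\mathrm{Graph}_{n_i}(F)$ and every sequence $\alpha_i\in\mathcal{M}_{n_i,n}$ with $\sum_i\alpha_i^*\alpha_i=1_n$, one has $\big(\sum_i\alpha_i^*x_i\alpha_i,\ \sum_i(1_p\otimes\alpha_i^* )T_i(1_p\otimes\alpha_i)\big)\in\mathrm{Graph}_n(F)$.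 $F$ is lower semicontinuous if each $\mathrm{Graph}_n(F)$ is closed in $\mathcal{M}_n^k\times\mathcal{M}_p(\mathcal{M}_n)$ (weak* topologies). An nc majorization function is a bounded lower semicontinuous convex multivalued nc function $F:K\to\mathcal{M}_p(\mathcal{M})$, for some $p\le\infty$. Majorization. For $x\in K_n$, $n<\infty$, $(\mathrm{id}_{\mathcal{M}_p}\otimes\mathrm{tr}_n)(F(x))=\{(\mathrm{id}_{\mathcal{M}_p}\otimes\mathrm{tr}_n)(\alpha):\alpha\in F(x)\}$. For two sets $S,T$ of self-adjoint elements, $S\le T$ means that for every $\beta\in T$ there is $\alpha\in S$ with $\alpha\le\beta$. For $k$-tuples of self-adjoint matrices $a,b\in\mathcal{M}_n^k$, $a\prec b$ means $$(\mathrm{id}_{\mathcal{M}_p}\otimes\mathrm{tr}_n)(F(a))\le(\mathrm{id}_{\mathcal{M}_p}\otimes\mathrm{tr}_n)(F(b))$$ for every $p\le\infty$ and every nc majorization function $F:K\to\mathcal{M}_p(\mathcal{M})$, where $K$ is any closed nc $k$-ball containing $a$ and $b$. *)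

(* Defs.v *)
From HB Require Import structures.
From mathcomp Require Import all_boot all_order all_algebra.
From mathcomp Require Import all_classical all_reals all_analysis.
From mathcomp Require Import complex ring lra.

Set Implicit Arguments.
Unset Strict Implicit.
Unset Printing Implicit Defensive.

Import Order.TTheory GRing.Theory Num.Theory.
Import numFieldNormedType.Exports.
Import Normc.

Local Open Scope classical_set_scope.
Local Open Scope ring_scope.

Lemma esumZ_le (R : realType) (I : choiceType) (c : R) (a : I -> \bar R) :
  0 <= c -> (forall i, 0 <= a i)%E ->
  (\esum_(i in [set: I]) (c%:E * a i) <= c%:E * \esum_(i in [set: I]) a i)%E.
Proof.
move=> c0 a0; apply: ge_ereal_sup => _ /= [X [finX XI]] <-.
rewrite -ge0_mule_fsumr//; apply: lee_wpmul2l; first by rewrite lee_fin.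
by apply: ereal_sup_ubound; exists X.
Qed.

Section l2.
Variables (R : realType) (I : choiceType).
Implicit Types f g : I -> R[i]^o.

Definition sqnorm f : \bar R :=
  (\esum_(i in [set: I]) (normc (f i) ^+ 2)%:E)%E.

Definition sqsummable : {pred I -> R[i]^o} :=
  [pred f | `[< (sqnorm f < +oo)%E >]].

Lemma sqnorm_ge0 f : (0 <= sqnorm f)%E.
Proof. by apply: esum_ge0 => i _; rewrite lee_fin sqr_ge0. Qed.

Lemma sqnormZD (c : R[i]) f g :
  (sqnorm (c *: f + g)%R
     <= (2 * normc c ^+ 2)%:E * sqnorm f + 2%:E * sqnorm g)%E.
Proof.
have c0 : 0 <= 2 * normc c ^+ 2 by rewrite mulr_ge0// sqr_ge0.
have fin0 (h : I -> R[i]^o) i : (0 <= (normc (h i) ^+ 2)%:E)%E.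
  by rewrite lee_fin sqr_ge0.
have := leeD (esumZ_le c0 (fin0 f)) (esumZ_le (ler0n R 2) (fin0 g)).
apply: le_trans.
rewrite -esumD; first last.
- by move=> i _; rewrite mule_ge0.
- by move=> i _; rewrite mule_ge0.
apply: le_esum => i _; rewrite lee_fin.
have := le_normcD (c * f i) (g i); rewrite normcM => h.
have n0 (z : R[i]) : 0 <= normc z by case: z => x y; rewrite sqrtr_ge0.
rewrite (@le_trans _ _ ((normc c * normc (f i) + normc (g i)) ^+ 2))//.
  by rewrite ler_sqr ?nnegrE// addr_ge0// mulr_ge0.
have := sqr_ge0 (normc c * normc (f i) - normc (g i)); nra.
Qed.

Lemma sqsummable_submod : submod_closed sqsummable.
Proof.
split=> [|c f g]; rewrite !inE.
  by rewrite /sqnorm esum1 ?ltry// => i _; rewrite normc0 expr0n.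
move=> fo go.
apply: le_lt_trans (sqnormZD _ _ _) _.
apply: lte_add_pinfty; apply: lte_mul_pinfty => //; rewrite lee_fin//.
by rewrite mulr_ge0// sqr_ge0.
Qed.

HB.instance Definition _ :=
  GRing.isSubmodClosed.Build R[i] (I -> R[i]^o) sqsummable sqsummable_submod.

Record l2 := L2 { l2val :> I -> R[i]^o ; _ : l2val \in sqsummable }.

HB.instance Definition _ := [isSub for l2val].
HB.instance Definition _ := [Choice of l2 by <:].
HB.instance Definition _ := [SubChoice_isSubLmodule of l2 by <:].
End l2.

Lemma l2_fin (R : realType) (I : choiceType) (x : l2 R I) : sqnorm x \is a fin_num.
Proof.
by rewrite ge0_fin_numE ?sqnorm_ge0//; case: x => x /=; rewrite inE.
Qed.

Section inner.
Variables (R : realType) (I : choiceType).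

Definition l2norm (x : l2 R I) : R := Num.sqrt (fine (sqnorm x)).

(* Sum of an absolutely summable real family, as the difference of the sums of
   its positive and negative parts. *)
Definition rsum (h : I -> R) : R :=
  fine (\esum_(i in [set: I]) (EFin \o h)^\+ i)%E
  - fine (\esum_(i in [set: I]) (EFin \o h)^\- i)%E.

Definition csum (h : I -> R[i]) : R[i] :=
  (rsum (fun i => complex.Re (h i)) +i* rsum (fun i => complex.Im (h i)))%C.

(* Linear in the first argument. *)
Definition inner (x y : l2 R I) : R[i] :=
  csum (fun i => (x i : R[i]) * (y i : R[i])^*).

Lemma sqr_l2norm (x : l2 R I) : (l2norm x ^+ 2)%:E = sqnorm x.
Proof.
by rewrite sqr_sqrtr ?fine_ge0 ?sqnorm_ge0// fineK// l2_fin.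
Qed.

End inner.

Section op.
Variables (R : realType) (I J : choiceType).
Implicit Types T : l2 R I -> l2 R J.

Definition bounded_linear : {pred l2 R I -> l2 R J} :=
  [pred T | `[< linear T /\
                exists c : R, forall x, l2norm (T x) <= c * l2norm x >]].

Lemma bounded_linearP T :
  reflect (linear T /\ exists2 c : R, 0 <= c &
             forall x, (sqnorm (T x) <= c%:E * sqnorm x)%E)
          (T \in bounded_linear).
Proof.
apply: (iffP idP) => [|[linT [c c0 Tc]]]; rewrite inE.
  move=> [linT [c Tc]]; split=> //; exists (c ^+ 2) => [|x]; first exact: sqr_ge0.
  rewrite -!sqr_l2norm -EFinM lee_fin -exprMn.
  by rewrite ler_sqr ?nnegrE ?sqrtr_ge0// (le_trans _ (Tc x))// sqrtr_ge0.
split=> //; exists (Num.sqrt c) => x.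
rewrite /l2norm -sqrtrM// ler_wsqrtr// -lee_fin EFinM !fineK ?l2_fin//.
Qed.

Lemma bounded_linear_submod : submod_closed bounded_linear.
Proof.
split=> [|c S T /bounded_linearP[linS [a a0 Sa]] /bounded_linearP[linT [b b0 Tb]]].
  apply/bounded_linearP; split=> [c x y|].
    by rewrite /GRing.zero/= scaler0 addr0.
  exists 0 => // x; rewrite mul0e (_ : (0 : l2 R I -> l2 R J) x = 0)//.
  rewrite /sqnorm esum1// => i _.
  have -> : (0 : l2 R J) i = 0 by [].
  by rewrite normc0 expr0n.
apply/bounded_linearP; split=> [d x y|].
  have E z : (c *: S + T) z = c *: S z + T z by [].
  by rewrite !E linS linT !scalerDr !scalerA (mulrC c) addrACA.
have c0 : 0 <= 2 * normc c ^+ 2 by rewrite mulr_ge0// sqr_ge0.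
have ca0 : 0 <= 2 * normc c ^+ 2 * a by apply: mulr_ge0.
have bb0 : 0 <= 2 * b by apply: mulr_ge0.
exists (2 * normc c ^+ 2 * a + 2 * b) => [|x]; first exact: addr_ge0.
apply: le_trans (sqnormZD c (S x) (T x)) _.
rewrite (EFinD (_ * a)) (@ge0_muleDl _ (sqnorm x)) ?lee_fin//.
apply: leeD; rewrite (EFinM _ a, EFinM _ b) -muleA.
  by rewrite lee_wpmul2l ?lee_fin.
by rewrite lee_wpmul2l ?lee_fin.
Qed.

HB.instance Definition _ := GRing.isSubmodClosed.Build R[i]
  (l2 R I -> l2 R J) bounded_linear bounded_linear_submod.

Record op := Op { opval :> l2 R I -> l2 R J ; _ : opval \in bounded_linear }.

HB.instance Definition _ := [isSub for opval].
HB.instance Definition _ := [Choice of op by <:].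
HB.instance Definition _ := [SubChoice_isSubLmodule of op by <:].
HB.instance Definition _ := isPointed.Build op 0.

Lemma op_linear (T : op) : linear T.
Proof. by case: T => T /= /bounded_linearP[]. Qed.

HB.instance Definition _ (T : op) :=
  GRing.isLinear.Build R[i] (l2 R I) (l2 R J) _ (opval T) (op_linear T).

Lemma op_bounded (T : op) : exists2 c : R, 0 <= c &
  forall x, (sqnorm (T x) <= c%:E * sqnorm x)%E.
Proof. by case: T => T /= /bounded_linearP[]. Qed.

Definition opnorm (T : op) : R :=
  sup [set l2norm (T x) | x in [set x | l2norm x <= 1]].

End op.

Lemma sqnormE (R : realType) (I : choiceType) (f g : I -> R[i]^o) :
  (forall i, f i = g i) -> sqnorm f = sqnorm g.
Proof. by move=> /funext->. Qed.

Lemma sqnorm_prod (R : realType) (K I : choiceType) (f : K * I -> R[i]^o) :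
  sqnorm f = (\esum_(k in [set: K]) sqnorm (fun i => f (k, i)))%E.
Proof.
rewrite /sqnorm esum_esum//=; last by move=> k i _ _; rewrite lee_fin sqr_ge0.
rewrite (_ : _ `*`` _ = setT)//; first by apply: eq_esum => -[].
by apply/seteqP; split.
Qed.

Lemma l2PE (R : realType) (I : choiceType) (a : R[i]) (x y : l2 R I) i :
  (a *: x + y) i = a * x i + y i.
Proof. by []. Qed.

Lemma l2_ext (R : realType) (I : choiceType) (x y : l2 R I) :
  (forall i, x i = y i) -> x = y.
Proof. by move=> xy; apply/val_inj/funext. Qed.

Section comp.
Variable R : realType.

Lemma idop_subproof (I : choiceType) :
  (@id (l2 R I)) \in @bounded_linear R I I.
Proof. by apply/bounded_linearP; split=> //; exists 1 => // x; rewrite mul1e. Qed.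

Definition idop (I : choiceType) : op R I I := Op (idop_subproof I).

Lemma opcomp_subproof (I J K : choiceType) (S : op R J K) (T : op R I J) :
  (S \o T) \in @bounded_linear R I K.
Proof.
apply/bounded_linearP; split=> [c x y|]; first by rewrite /= !linearP.
have [[a a0 Sa] [b b0 Tb]] := (op_bounded S, op_bounded T).
exists (a * b) => [|x]; first exact: mulr_ge0.
rewrite EFinM -muleA (le_trans (Sa _))//.
by rewrite lee_wpmul2l ?lee_fin.
Qed.

Definition opcomp (I J K : choiceType) (S : op R J K) (T : op R I J) : op R I K :=
  Op (opcomp_subproof S T).

Definition is_adjoint (I J : choiceType) (T : op R I J) (S : op R J I) : Prop :=
  forall x y, inner (T x) y = inner x (S y).

(* The adjoint, which exists (Riesz) and is unique; the default 0 is never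
   reached. *)
Definition adj (I J : choiceType) (T : op R I J) : op R J I :=
  xget 0 [set S | is_adjoint T S].

End comp.

Section ampl.
Variables (R : realType) (K : choiceType).

Lemma slice_subproof (I : choiceType) (x : l2 R (K * I)%type) k :
  (fun i => x (k, i)) \in @sqsummable R I.
Proof.
rewrite inE; have := l2_fin x; rewrite ge0_fin_numE ?sqnorm_ge0//.
apply: le_lt_trans; rewrite sqnorm_prod.
rewrite (esumID [set k])//; last by move=> j _; exact: sqnorm_ge0.
rewrite setTI esum_set1 ?sqnorm_ge0// leeDl//.
by apply: esum_ge0 => j _; exact: sqnorm_ge0.
Qed.

Definition slice (I : choiceType) (x : l2 R (K * I)%type) (k : K) : l2 R I :=
  L2 (slice_subproof x k).

Variables (I J : choiceType) (T : op R I J).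

Lemma ampl_bound : exists2 c : R, 0 <= c & forall x : l2 R (K * I)%type,
  (sqnorm (fun p : K * J => T (slice x p.1) p.2 : R[i]^o) <= c%:E * sqnorm x)%E.
Proof.
have [c c0 Tc] := op_bounded T; exists c => // x.
rewrite [in leRHS]sqnorm_prod sqnorm_prod.
apply: (@le_trans _ _
    (\esum_(k in [set: K]) (c%:E * sqnorm (slice x k)))%E); last first.
  by apply: esumZ_le => // k; exact: sqnorm_ge0.
apply: le_esum => k _; have := Tc (slice x k).
by rewrite (@sqnormE _ _ (fun i => T (slice x (k, i).1) (k, i).2) (T (slice x k))).
Qed.

Lemma ampl_val_subproof (x : l2 R (K * I)%type) :
  (fun p : K * J => T (slice x p.1) p.2 : R[i]^o) \in @sqsummable R (K * J)%type.
Proof.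
have [c c0 Tc] := ampl_bound.
rewrite inE; apply: le_lt_trans (Tc x) _.
by apply: lte_mul_pinfty; rewrite ?lee_fin// -ge0_fin_numE ?sqnorm_ge0 ?l2_fin.
Qed.

Definition ampl_val (x : l2 R (K * I)%type) : l2 R (K * J)%type :=
  L2 (ampl_val_subproof x).

Lemma ampl_subproof : ampl_val \in @bounded_linear R (K * I)%type (K * J)%type.
Proof.
apply/bounded_linearP; split; last exact: ampl_bound.
move=> a x y; apply: l2_ext => -[k j]; rewrite l2PE /=.
have -> : slice (a *: x + y) k = a *: slice x k + slice y k.
  by apply: l2_ext => i; rewrite l2PE.
by rewrite linearP.
Qed.

(* [ampl T] is 1 (x) T on l2 (K * I), the Hilbert space tensor product of
   l2 K and l2 I. *)
Definition ampl : op R (K * I)%type (K * J)%type := Op ampl_subproof.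

End ampl.

Section ins.
Variables (R : realType) (I J : choiceType) (j : J).

Lemma ins_norm (f : I -> R[i]^o) :
  sqnorm (fun p : I * J => if p.2 == j then f p.1 else 0) = sqnorm f.
Proof.
rewrite sqnorm_prod; apply: eq_esum => i _.
rewrite /sqnorm (esumID [set j])//=; last first.
  by move=> ? _; rewrite lee_fin sqr_ge0.
rewrite setTI esum_set1 ?lee_fin ?sqr_ge0// eqxx setTI esum1 ?adde0// => j' /eqP.
by move=> /negPf ->; rewrite normc0 expr0n.
Qed.

Lemma ins_val_subproof (x : l2 R I) :
  (fun p : I * J => if p.2 == j then x p.1 else 0) \in @sqsummable R (I * J)%type.
Proof. by rewrite inE ins_norm -ge0_fin_numE ?sqnorm_ge0 ?l2_fin. Qed.

Definition ins_val (x : l2 R I) : l2 R (I * J)%type := L2 (ins_val_subproof x).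

Lemma ins_subproof : ins_val \in @bounded_linear R I (I * J)%type.
Proof.
apply/bounded_linearP; split; last first.
  by exists 1 => // x; rewrite mul1e /= ins_norm.
move=> a x y; apply: l2_ext => -[i j']; rewrite l2PE /=.
by case: eqP => _; rewrite ?l2PE// mulr0 addr0.
Qed.

(* [ins j x] is x (x) e_j. *)
Definition ins : op R I (I * J)%type := Op ins_subproof.

End ins.

Section basis.
Variables (R : realType) (I : choiceType) (j : I).

Lemma basis_subproof : (fun i => (i == j)%:R) \in @sqsummable R I.
Proof.
rewrite inE /sqnorm (esumID [set j])//; last by move=> ? _; rewrite lee_fin sqr_ge0.
rewrite setTI esum_set1 ?lee_fin ?sqr_ge0// setTI esum1 ?adde0 ?ltry// => i /eqP.
by move=> /negPf ->; rewrite normc0 expr0n.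
Qed.

Definition basis : l2 R I := L2 basis_subproof.

End basis.

Section weakstar.
Variables (R : realType) (I J : choiceType).

(* The weak* (ultraweak) topology is generated by the functionals
   T |-> \sum_m <T (x_m), y_m> with square-summable sequences of vectors
   (x_m), (y_m), i.e. T |-> <(1 (x) T) x, y> with x, y in l2 (nat * _). On
   finite-dimensional spaces this is the norm topology. *)
Definition normal_functionals (T : op R I J) :
    {ptws l2 R (nat * I)%type * l2 R (nat * J)%type -> R[i]^o} :=
  fun v => inner (ampl nat T v.1) v.2.

HB.instance Definition _ :=
  Topological.copy (op R I J) (initial_topology normal_functionals).

End weakstar.

Section positivity.
Variables (R : realType) (I : choiceType).
Implicit Types S T : op R I I.

Definition selfadjoint T := adj T = T.

(* The order of R[i] makes [0 <= z] say that z is real and nonnegative. *)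
Definition op_pos T := forall x, 0 <= inner (T x) x.

Definition op_le S T := op_pos (T - S).

Definition unitary T :=
  opcomp (adj T) T = idop R I /\ opcomp T (adj T) = idop R I.

Definition set_le (A B : set (op R I I)) :=
  forall T, B T -> exists2 S, A S & op_le S T.

End positivity.

Definition compress (R : realType) (I J : choiceType) (a : op R I J)
    (T : op R J J) : op R I I :=
  opcomp (adj a) (opcomp T a).

(* The dimensions 1, 2, ..., oo; H_n is realized as l2 (idx n). *)
Inductive dim := Fin (n : nat) of (0 < n)%N | Inf.

Definition idx (n : dim) : choiceType :=
  match n with Fin n _ => 'I_n : choiceType | Inf => nat : choiceType end.

Section majorization.
Variables (R : realType) (k : nat).
Implicit Types (n p : dim).

(* Bounded operators from H_n to H_m. *)
Definition M m n := op R (idx n) (idx m).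

(* M_p(M_n), as the bounded operators on H_p (x) H_n = l2 (idx p * idx n). *)
Definition MpM p n := op R (idx p * idx n)%type (idx p * idx n)%type.

Definition id_tensor p (n n' : dim) (T : M n' n) :
    op R (idx p * idx n)%type (idx p * idx n')%type :=
  ampl (idx p) T.

Definition nc_ball (r : R) n : set ('I_k -> M n n) :=
  [set x | op_le (\sum_j opcomp (x j) (adj (x j)))
                 ((r ^+ 2)%:C%C *: idop R (idx n))].

(* A multivalued nc function on the ball of radius r is represented by a family
   F defined on all tuples; its values outside the ball are never used. *)
Section functions.
Variables (r : R) (p : dim) (F : forall n, ('I_k -> M n n) -> set (MpM p n)).

Definition multivalued_nc := forall n x, nc_ball r x ->
  [/\ F x !=set0,
      F x `<=` [set T : MpM p n | selfadjoint T],
      forall a : M n n, unitary a ->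
        F (fun j => compress a (x j)) = [set compress (id_tensor p a) T | T in F x]
    & F x = [set T + P | T in F x & P in [set P : MpM p n | op_pos P]]].

Definition bounded_nc := exists2 lambda : R, 0 < lambda &
  forall n x, nc_ball r x -> forall T : MpM p n, F x T ->
    exists S, [/\ F x S, op_le S T & opnorm S <= lambda].

Definition nc_graph n : set ({ptws 'I_k -> M n n} * MpM p n) :=
  [set z | nc_ball r z.1 /\ F z.1 z.2].
Arguments nc_graph : clear implicits.

(* Series are summed in the weak* topology; for the bounded sequences considered
   here they always converge. Finite combinations have a i = 0 eventually. *)
Definition convex_nc := forall n (N : nat -> dim)
    (x : forall i, 'I_k -> M (N i) (N i)) (T : forall i, MpM p (N i))
    (a : forall i, M (N i) n),
  (forall i, nc_graph (N i) (x i, T i)) ->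
  (exists c : R, forall i, (forall j, opnorm (x i j) <= c) /\ opnorm (T i) <= c) ->
  series (fun i => opcomp (adj (a i)) (a i)) @ \oo --> idop R (idx n) ->
  forall (y : 'I_k -> M n n) (S : MpM p n),
    (forall j, series (fun i => compress (a i) (x i j)) @ \oo --> y j) ->
    series (fun i => compress (id_tensor p (a i)) (T i)) @ \oo --> S ->
  nc_graph n (y, S).

Definition lsc_nc := forall n, closed (nc_graph n).

Definition nc_majorization_function :=
  [/\ multivalued_nc, bounded_nc, lsc_nc & convex_nc].

End functions.

Section finite.
Variables (n : nat) (n_gt0 : (0 < n)%N).

(* (id (x) tr_n)(T) = 1/n \sum_j V_j^* T V_j where V_j x = x (x) e_j. *)
Definition ptrace p (T : MpM p (Fin n_gt0)) : M p p :=
  (n%:R^-1 : R[i]) *: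
    \sum_(j : 'I_n) compress (ins R (idx p) (j : idx (Fin n_gt0))) T.

Definition tr (T : M (Fin n_gt0) (Fin n_gt0)) : R[i] :=
  let e (j : 'I_n) := basis R (j : idx (Fin n_gt0)) in
  n%:R^-1 * \sum_(j : 'I_n) inner (T (e j)) (e j).

Definition nc_majorized (a b : 'I_k -> M (Fin n_gt0) (Fin n_gt0)) :=
  forall (p : dim) (r : R) (F : forall n, ('I_k -> M n n) -> set (MpM p n)),
    0 < r -> nc_ball r a -> nc_ball r b -> nc_majorization_function r F ->
    set_le [set ptrace T | T in F _ a] [set ptrace T | T in F _ b].

End finite.
End majorization.

Section maps.
Variables (R : realType) (I : choiceType).

(* Positivity of a d x d matrix of operators acting on the direct sum of d
   copies of l2 I. *)
Definition mx_pos d (T : 'M[op R I I]_d) := forall x : 'I_d -> l2 R I,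
  0 <= \sum_i \sum_j inner (T i j (x j)) (x i).

Definition completely_positive (Phi : op R I I -> op R I I) :=
  forall d (T : 'M[op R I I]_d), mx_pos T -> mx_pos (map_mx Phi T).

Definition unital (Phi : op R I I -> op R I I) := Phi (idop R I) = idop R I.

End maps.

Definition trace_preserving (R : realType) n (n_gt0 : (0 < n)%N)
    (Phi : M R (Fin n_gt0) (Fin n_gt0) -> M R (Fin n_gt0) (Fin n_gt0)) :=
  forall T, tr (Phi T) = tr T.

(* Main.v *)
From HB Require Import structures.
Require Import Defs.
From mathcomp Require Import all_boot all_order all_algebra.
From mathcomp Require Import all_classical all_reals all_analysis.
From mathcomp Require Import complex ring lra.

(** Majorization of [a] by [b] amounts to the existence of a channel from [b] to
    [a], for the following reasons.

    Suppose that [Phi] is unital, completely positive and trace preserving with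
    [Phi b = a]. It has a Kraus form [Phi T = sum_w w^* T w] ([kraus]), obtained
    by writing the Choi operator as a sum of rank one operators ([pos_factor]).
    As [sum_w w^* w = 1], convexity of a majorization function [F], applied to
    copies of [(b, T)] with [T] in [F b], puts
    [S = sum_w (1 (x) w)^* T (1 (x) w)] in [F a]; as [sum_w w w^* = 1], the
    operators [S] and [T] have the same partial trace ([channel_majorized]).

    Conversely a single function [majfun] with values in the matrices of size
    [n + 1] suffices. An operator [T] belongs to [majfun x] when it dominates a
    positive block operator [E] of which [n] rows and columns form the Choi
    matrix of a unital completely positive map [Psi] on the [n] x [n] matrices,
    while the remaining diagonal block is bounded and dominates both
    [Re x_i - Re Psi(b_i)] and its opposite for all [i]. This penalty makes sense
    for every [x] in the ball, whether or not [x] is the image of [b] under a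
    unital completely positive map. The conditions on [E] are linear and survive
    compressions and sums ([cone]), which gives convexity. The graph is closed
    although [E] is quantified existentially, because the admissible [E] form a
    weakly compact set ([pos_ultra_lim], which rests on the Riesz
    representation [form_op]). Convergence of an infinite combination is also
    handled by this compactness.

    The identity map shows that [majfun b] contains a block operator [E0] without
    penalty, whose partial trace is [1/n] on the Choi part. Majorization produces
    an admissible [E] for [a] with [ptrace E <= ptrace E0]. Both Choi parts have
    trace one, so that the two partial traces are equal. Hence the penalty block
    of [E] is a positive operator of trace zero, which forces [Psi b = a], and
    the trace of the Choi block [(j, l)] is that of the matrix unit, which says
    that [Psi] preserves the trace ([majorized_channel]).

    The weak* topology enters only through the continuity of the matrix
    coefficients [T |-> <T x, y>] ([op_Re_continuous]). *)

Set Implicit Arguments.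
Unset Strict Implicit.
Unset Printing Implicit Defensive.

Import Order.TTheory GRing.Theory Num.Theory.
Import numFieldNormedType.Exports.
Import Normc.

Local Open Scope classical_set_scope.
Local Open Scope ring_scope.

(** * Absolutely summable families and the inner product *)

Section rsum.
Variables (R : realType) (I : choiceType).
Implicit Types f g h : I -> R.

(** Absolute summability. *)
Definition rsummable h := summable [set: I] (EFin \o h).

Lemma rsummable_le f g : (forall i, `|f i| <= g i) -> rsummable g -> rsummable f.
Proof.
move=> fg; apply: le_lt_trans; apply: le_esum => i _ /=.
by rewrite lee_fin (le_trans (fg i))// ler_norm.
Qed.

Lemma rsummableD f g : rsummable f -> rsummable g -> rsummable (f \+ g).
Proof.
move=> sf sg; have := summableD sf sg; congr summable.
Qed.

Lemma rsummableZ c f : rsummable f -> rsummable (c \*o f).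
Proof.
rewrite /rsummable /summable => sf.
apply: (@le_lt_trans _ _ (`|c|%:E * \esum_(i in [set: I]) (`|f i|)%:E)%E).
  apply: le_trans (esumZ_le _ _) => [|//|i]; last by rewrite lee_fin.
  by apply: le_esum => i _ /=; rewrite normrM EFinM.
by apply: lte_mul_pinfty; rewrite ?lee_fin.
Qed.

Lemma rsummable_esum f : (forall i, 0 <= f i) -> rsummable f ->
  (\esum_(i in [set: I]) (f i)%:E)%E \is a fin_num.
Proof.
move=> f0; rewrite /rsummable summableE; congr (_ \is a fin_num).
by apply: eq_esum => i _ /=; rewrite ger0_norm.
Qed.

(** The sum of a difference of nonnegative families does not depend on the
    decomposition; additivity of [rsum] follows. *)
Lemma rsum_sub f g : (forall i, 0 <= f i) -> (forall i, 0 <= g i) ->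
  rsummable f -> rsummable g ->
  rsum (f \- g) = fine (\esum_(i in [set: I]) (f i)%:E)%E
                  - fine (\esum_(i in [set: I]) (g i)%:E)%E.
Proof.
move=> f0 g0 sf sg.
have E : (EFin \o (f \- g)%R = (EFin \o f) \- (EFin \o g))%E by [].
have H : ((\esum_(i in [set: I]) (EFin \o (f \- g)%R)^\+ i)
  - (\esum_(i in [set: I]) (EFin \o (f \- g)%R)^\- i) =
  (\esum_(i in [set: I]) (f i)%:E) - \esum_(i in [set: I]) (g i)%:E)%E.
  by rewrite E; apply: esumB => // i _; rewrite /= lee_fin.
have sfg : summable [set: I] (EFin \o (f \- g)%R) by rewrite E; exact: summableB.
have finp : (\esum_(i in [set: I]) ((EFin \o (f \- g)%R)^\+ i))%E \is a fin_num.
  have := summable_funepos sfg; rewrite summableE; congr (_ \is a fin_num).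
  by apply: eq_esum => i _ /=; rewrite gee0_abs.
have finn : (\esum_(i in [set: I]) ((EFin \o (f \- g)%R)^\- i))%E \is a fin_num.
  have := summable_funeneg sfg; rewrite summableE; congr (_ \is a fin_num).
  by apply: eq_esum => i _ /=; rewrite gee0_abs.
by rewrite /rsum -!fineB// ?rsummable_esum// H.
Qed.

Lemma rsum_ge0E f : (forall i, 0 <= f i) -> rsummable f ->
  rsum f = fine (\esum_(i in [set: I]) (f i)%:E)%E.
Proof.
move=> f0 sf; have s0 : rsummable (fun=> 0 : R).
  by rewrite /rsummable /summable esum1 ?ltry// => i _ /=; rewrite normr0.
have -> : f = f \- (fun=> 0) by apply/funext => i /=; rewrite subr0.
rewrite rsum_sub// [X in _ - X](_ : _ = 0) ?subr0; last by rewrite esum1.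
by congr fine; apply: eq_esum => i _ /=; rewrite subr0.
Qed.

(* Positive and negative parts. *)
Let pos f i := Num.max (f i) 0.
Let neg f i := Num.max (- f i) 0.

Let posneg f : f = pos f \- neg f.
Proof.
apply/funext => i; rewrite /pos /neg /=.
by have [] := leP (f i) 0; have [] := leP (- f i) 0; lra.
Qed.

Let spos f : rsummable f -> rsummable (pos f).
Proof.
move=> sf; apply: (@rsummable_le _ (fun i => `|f i|)).
  move=> i; rewrite /pos; have [h|h] := leP (f i) 0; first by rewrite normr0.
  by [].
by rewrite /rsummable/summable; under eq_esum do rewrite /= normr_id.
Qed.

Let sneg f : rsummable f -> rsummable (neg f).
Proof.
move=> sf; apply: (@rsummable_le _ (fun i => `|f i|)).
  move=> i; rewrite /neg; have [h|h] := leP (- f i) 0; first by rewrite normr0.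
  by rewrite normrN.
by rewrite /rsummable/summable; under eq_esum do rewrite /= normr_id.
Qed.

Let pos0 f i : 0 <= pos f i. Proof. by rewrite /pos le_max lexx orbT. Qed.
Let neg0 f i : 0 <= neg f i. Proof. by rewrite /neg le_max lexx orbT. Qed.

Let esumfD f g : (forall i, 0 <= f i) -> (forall i, 0 <= g i) ->
  rsummable f -> rsummable g ->
  fine (\esum_(i in [set: I]) ((f \+ g)%R i)%:E)%E =
  fine (\esum_(i in [set: I]) (f i)%:E)%E + fine (\esum_(i in [set: I]) (g i)%:E)%E.
Proof.
move=> f0 g0 sf sg; rewrite -fineD ?rsummable_esum// -esumD//; first last.
- by move=> i _; rewrite lee_fin.
- by move=> i _; rewrite lee_fin.
Qed.

Lemma rsumD f g : rsummable f -> rsummable g -> rsum (f \+ g) = rsum f + rsum g.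
Proof.
move=> sf sg; have spf := spos sf; have snf := sneg sf; have spg := spos sg; have sng := sneg sg.
have -> : f \+ g = (pos f \+ pos g) \- (neg f \+ neg g).
  apply/funext => i /=.
  rewrite [in LHS](posneg f) [in LHS](posneg g) /=; ring.
have rsE h : rsummable h -> rsum h = fine (\esum_(i in [set: I]) (pos h i)%:E)%E
    - fine (\esum_(i in [set: I]) (neg h i)%:E)%E.
  move=> sh; rewrite {1}(posneg h).
  exact: (rsum_sub (pos0 h) (neg0 h) (spos sh) (sneg sh)).
rewrite rsum_sub; do ?[exact: rsummableD | by move=> i; rewrite /= addr_ge0].
rewrite (rsE f sf) (rsE g sg) (esumfD (pos0 f) (pos0 g) spf spg).
by rewrite (esumfD (neg0 f) (neg0 g) snf sng) opprD addrACA.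
Qed.

Lemma rsumN f : rsum (\- f) = - rsum f.
Proof.
rewrite /rsum opprB; congr (fine _ - fine _); apply: eq_esum => i _.
  by rewrite funeposE funenegE.
by rewrite funeposE funenegE /= opprK.
Qed.

Lemma esumZ c (a : I -> \bar R) : 0 <= c -> (forall i, 0 <= a i)%E ->
  (\esum_(i in [set: I]) (c%:E * a i) = c%:E * \esum_(i in [set: I]) a i)%E.
Proof.
rewrite le_eqVlt => /predU1P[<- _|c0 a0].
  by rewrite mul0e esum1// => i _; rewrite mul0e.
apply/eqP; rewrite eq_le (esumZ_le (ltW c0) a0)/=.
have cV0 : 0 <= c^-1 by rewrite invr_ge0 ltW.
have H := @esumZ_le R I c^-1 (fun i => c%:E * a i)%E cV0.
have {}H := H (fun i => ltac:(by rewrite mule_ge0// lee_fin ltW)).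
rewrite [leRHS](_ : _ = (c * c^-1)%:E * \esum_(i in [set: I]) (c%:E * a i))%E; last first.
  by rewrite mulfV ?gt_eqF// mul1e.
rewrite EFinM -muleA lee_wpmul2l// ?lee_fin ?(ltW c0)//.
rewrite (le_trans _ H)//; apply: le_esum => i _.
by rewrite muleA -EFinM mulVf ?gt_eqF// mul1e.
Qed.

Lemma rsumZ c f : rsum (c \*o f) = c * rsum f.
Proof.
wlog c0 : c f / 0 <= c => [H|].
  have [/H//|/ltW c0] := leP 0 c.
  have -> : c \*o f = (- c) \*o (\- f) by apply/funext => i /=; rewrite mulrNN.
  by rewrite H ?oppr_ge0// rsumN mulrNN.
rewrite /rsum.
have E (g : I -> \bar R) : (forall i, 0 <= g i)%E ->
    fine (\esum_(i in [set: I]) (c%:E * g i))%E = c * fine (\esum_(i in [set: I]) g i)%E.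
  move=> g0; rewrite esumZ//.
  have := esum_ge0 (fun i (_ : [set: I] i) => g0 i).
  case: (esum _ _) => [r _|_|//]; first by [].
  move: c0; rewrite le_eqVlt => /predU1P[<-|c0]; first by rewrite mul0e mul0r.
  by rewrite gt0_muley ?lte_fin//= mulr0.
rewrite mulrBr -!E//; congr (fine _ - fine _); apply: eq_esum => i _.
  by rewrite !funeposE maxe_pMr ?lee_fin// mule0.
by rewrite !funenegE maxe_pMr ?lee_fin// mule0 muleN.
Qed.

Lemma rsum_single (j : I) c : rsum (fun i => if i == j then c else 0 : R) = c.
Proof.
wlog c0 : c / 0 <= c => [H|].
  have [/H//|/ltW c0] := leP 0 c; rewrite -[RHS]opprK -[in RHS](H (- c)) ?oppr_ge0//.
  by rewrite -rsumN; congr rsum; apply/funext => i /=; case: ifP; rewrite ?opprK ?oppr0.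
have f0 i : 0 <= (if i == j then c else 0) by case: ifP.
have E : (\esum_(i in [set: I]) (if i == j then c else 0)%:E = c%:E)%E.
  rewrite (esumID [set j])//; last by move=> i _; rewrite lee_fin.
  rewrite setTI esum_set1 ?lee_fin// eqxx setTI esum1 ?adde0// => i /eqP.
  by move=> /negPf ->.
rewrite rsum_ge0E ?E//.
by rewrite /rsummable /summable; under eq_esum do rewrite /= ger0_norm//; rewrite E ltry.
Qed.

End rsum.

Section csum.
Variables (R : realType) (I : choiceType).
Implicit Types f g h : I -> R[i].

(** Absolute summability, tested on real and imaginary parts. *)
Definition csummable h :=
  rsummable (fun i => complex.Re (h i)) /\ rsummable (fun i => complex.Im (h i)).

Lemma csumD f g : csummable f -> csummable g ->
  csum (fun i => f i + g i) = csum f + csum g.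
Proof.
move=> [rf jf] [rg jg]; rewrite /csum.
have -> : (fun i => complex.Re (f i + g i)) =
    (fun i => complex.Re (f i)) \+ (fun i => complex.Re (g i)).
  by apply/funext => i /=; case: (f i) (g i) => [? ?] [? ?].
have -> : (fun i => complex.Im (f i + g i)) =
    (fun i => complex.Im (f i)) \+ (fun i => complex.Im (g i)).
  by apply/funext => i /=; case: (f i) (g i) => [? ?] [? ?].
by rewrite !rsumD.
Qed.

Lemma csumZ (c : R[i]) f : csummable f -> csum (fun i => c * f i) = c * csum f.
Proof.
case: c => a b [rf jf]; rewrite /csum.
have -> : (fun i => complex.Re ((a +i* b)%C * f i)) =
    (a \*o (fun i => complex.Re (f i))) \+ ((- b) \*o (fun i => complex.Im (f i))).
  by apply/funext => i /=; case: (f i) => [? ?] /=; rewrite mulNr.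
have -> : (fun i => complex.Im ((a +i* b)%C * f i)) =
    (a \*o (fun i => complex.Im (f i))) \+ (b \*o (fun i => complex.Re (f i))).
  by apply/funext => i /=; case: (f i) => [? ?] /=.
rewrite !rsumD ?rsumZ; try exact: rsummableZ.
by rewrite mulNr.
Qed.

Lemma conj_complexE (z : R[i]) : z^* = (complex.Re z -i* complex.Im z)%C.
Proof. by case: z. Qed.

Lemma csum_conj f : csum (fun i => (f i)^*) = (csum f)^*.
Proof.
rewrite conj_complexE /csum /= -rsumN; congr Complex; congr rsum.
  by apply/funext => i; case: (f i).
by apply/funext => i /=; case: (f i).
Qed.

Lemma csum_single (j : I) (c : R[i]) : csum (fun i => if i == j then c else 0) = c.
Proof.
rewrite /csum [RHS](_ : _ = (complex.Re c +i* complex.Im c)%C); last by case: c.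
rewrite -[in RHS](rsum_single j (complex.Re c)) -[in RHS](rsum_single j (complex.Im c)).
by congr Complex; congr rsum; apply/funext => i /=; case: ifP.
Qed.

End csum.

Section inner.
Variables (R : realType) (I : choiceType).
Implicit Types x y z : l2 R I.

(** The squared norm, as a real number. *)
Definition nrm2 x : R := fine (sqnorm x).

Lemma nrm2E x : (nrm2 x)%:E = sqnorm x.
Proof. by rewrite fineK// l2_fin. Qed.

Lemma nrm2_ge0 x : 0 <= nrm2 x.
Proof. by rewrite fine_ge0// sqnorm_ge0. Qed.

Lemma l2norm_sqr x : l2norm x ^+ 2 = nrm2 x.
Proof. by rewrite sqr_sqrtr// nrm2_ge0. Qed.

Lemma sqr_normcE (z : R[i]) : normc z ^+ 2 = complex.Re z ^+ 2 + complex.Im z ^+ 2.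
Proof. by case: z => a b /=; rewrite sqr_sqrtr// addr_ge0// sqr_ge0. Qed.

Lemma rsummable_sqr x : rsummable (fun i => normc (x i) ^+ 2).
Proof.
rewrite /rsummable /summable; have := l2_fin x; rewrite ge0_fin_numE ?sqnorm_ge0//.
congr (_ < _)%E; apply: eq_esum => i _ /=.
by rewrite ger0_norm// sqr_ge0.
Qed.

Lemma inner_summable x y : csummable (fun i => (x i : R[i]) * (y i : R[i])^*).
Proof.
have s := rsummableD (rsummable_sqr x) (rsummable_sqr y).
split; apply: rsummable_le s => i /=; rewrite !sqr_normcE ler_norml;
  case: (x i) (y i) => [a b] [c d] /=; apply/andP; split;
  have := sqr_ge0 (a - c); have := sqr_ge0 (a + c); have := sqr_ge0 (b - d);
  have := sqr_ge0 (b + d); have := sqr_ge0 (a - d); have := sqr_ge0 (a + d);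
  have := sqr_ge0 (b - c); have := sqr_ge0 (b + c); nra.
Qed.

Lemma inner_lin c x y z : inner (c *: x + y) z = c * inner x z + inner y z.
Proof.
rewrite /inner -csumZ; last exact: inner_summable.
rewrite -csumD; [|have [sx sy] := inner_summable (c *: x) z|exact: inner_summable].
  by congr csum; apply/funext => i; rewrite l2PE mulrDl mulrA.
have E : (fun i => (c *: x) i * (z i : R[i])^*) = (fun i => c * (x i * (z i : R[i])^*)).
  by apply/funext => i; rewrite mulrA.
by move: (inner_summable (c *: x) z); rewrite E.
Qed.

Lemma innerC x y : inner y x = (inner x y)^*.
Proof.
rewrite /inner -csum_conj; congr csum; apply/funext => i.
by rewrite rmorphM /= conjCK mulrC.
Qed.

Lemma innerxx x : inner x x = (nrm2 x)%:C%C.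
Proof.
have E : (fun i => (x i : R[i]) * (x i : R[i])^*) = (fun i => (normc (x i) ^+ 2)%:C%C).
  apply/funext => i; rewrite sqr_normcE; case: (x i) => a b /=.
  by apply/eqP; rewrite eq_complex /=; apply/andP; split; apply/eqP; ring.
rewrite /inner /csum.
have -> : (fun i => complex.Re (x i * (x i : R[i])^*)) = (fun i => normc (x i) ^+ 2).
  by apply/funext => i; rewrite (congr1 (@^~ i) E).
have -> : (fun i => complex.Im (x i * (x i : R[i])^*)) = (fun i => 0).
  by apply/funext => i; rewrite (congr1 (@^~ i) E).
rewrite (_ : rsum (fun=> 0) = 0); last first.
  rewrite rsum_ge0E//; first by rewrite esum1.
  by rewrite /rsummable /summable esum1 ?ltry// => i _ /=; rewrite normr0.
congr Complex; rewrite rsum_ge0E//; first by move=> i; exact: sqr_ge0.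
exact: rsummable_sqr.
Qed.

Lemma inner_basis x j : inner x (Defs.basis R j) = x j.
Proof.
rewrite /inner -[RHS](csum_single j); congr csum; apply/funext => i /=.
by case: eqP => [->|_]; rewrite ?conjC1 ?mulr1// conjC0 mulr0.
Qed.

End inner.

Section inner_theory.
Variables (R : realType) (I : choiceType).
Implicit Types x y z : l2 R I.
Notation Re := (@complex.Re R).

Lemma innerDl x y z : inner (x + y) z = inner x z + inner y z.
Proof. by rewrite -{1}[x]scale1r inner_lin mul1r. Qed.

Lemma inner0l z : inner 0 z = 0.
Proof.
have /eqP := innerDl 0 0 z.
by rewrite addr0 addrC -subr_eq subrr => /eqP <-.
Qed.

Lemma innerZl c x z : inner (c *: x) z = c * inner x z.
Proof. by rewrite -[c *: x]addr0 inner_lin inner0l addr0. Qed.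

Lemma innerNl x z : inner (- x) z = - inner x z.
Proof. by rewrite -scaleN1r innerZl mulN1r. Qed.

Lemma innerBl x y z : inner (x - y) z = inner x z - inner y z.
Proof. by rewrite innerDl innerNl. Qed.

Lemma innerDr x y z : inner z (x + y) = inner z x + inner z y.
Proof. by rewrite ![inner z _]innerC innerDl rmorphD. Qed.

Lemma inner0r z : inner z 0 = 0.
Proof. by rewrite innerC inner0l rmorph0. Qed.

Lemma innerZr c x z : inner z (c *: x) = c^* * inner z x.
Proof. by rewrite ![inner z _]innerC innerZl rmorphM. Qed.

Lemma innerNr x z : inner z (- x) = - inner z x.
Proof. by rewrite ![inner z _]innerC innerNl rmorphN. Qed.

Lemma innerBr x y z : inner z (x - y) = inner z x - inner z y.
Proof. by rewrite innerDr innerNr. Qed.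

Lemma inner_suml T (r : seq T) (P : pred T) (F : T -> l2 R I) z :
  inner (\sum_(i <- r | P i) F i) z = \sum_(i <- r | P i) inner (F i) z.
Proof.
by apply: (big_morph (fun x => inner x z)) => [x y|]; rewrite ?innerDl ?inner0l.
Qed.

Lemma inner_sumr T (r : seq T) (P : pred T) (F : T -> l2 R I) z :
  inner z (\sum_(i <- r | P i) F i) = \sum_(i <- r | P i) inner z (F i).
Proof.
by apply: (big_morph (inner z)) => [x y|]; rewrite ?innerDr ?inner0r.
Qed.

Lemma inner_basisl x j : inner (Defs.basis R j) x = (x j : R[i])^*.
Proof. by rewrite innerC inner_basis. Qed.

Lemma inner_bb (i j : I) : inner (Defs.basis R i) (Defs.basis R j) = (i == j)%:R.
Proof. by rewrite inner_basis /= eq_sym. Qed.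

Lemma inner_extr x y : (forall z, inner x z = inner y z) -> x = y.
Proof. by move=> xy; apply: l2_ext => i; rewrite -!inner_basis. Qed.

Lemma inner_extl x y : (forall z, inner z x = inner z y) -> x = y.
Proof. by move=> xy; apply: inner_extr => z; rewrite ![inner _ z]innerC xy. Qed.

Lemma cRe_conj (z : R[i]) : Re z^* = Re z.
Proof. by case: z. Qed.

Lemma cReD (u v : R[i]) : Re (u + v) = Re u + Re v.
Proof. by case: u v => [? ?] [? ?]. Qed.

Lemma cReN (u : R[i]) : Re (- u) = - Re u.
Proof. by case: u. Qed.

Lemma cReZ (t : R) (u : R[i]) : Re (t%:C%C * u) = t * Re u.
Proof. by case: u => a b /=; rewrite mul0r subr0. Qed.

Lemma cRe_sum T (r : seq T) (P : pred T) (F : T -> R[i]) :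
  Re (\sum_(i <- r | P i) F i) = \sum_(i <- r | P i) Re (F i).
Proof. by apply: (big_morph Re) => // x y; rewrite cReD. Qed.

Lemma conj_real (t : R) : (t%:C%C : R[i])^* = t%:C%C.
Proof. by rewrite conj_complexE /= oppr0. Qed.

Lemma ge0_Re (z : R[i]) : 0 <= z -> 0 <= Re z.
Proof. by rewrite lecE /= => /andP[]. Qed.

Lemma nrm2_Re x : nrm2 x = Re (inner x x).
Proof. by rewrite innerxx. Qed.

Lemma nrm2D x y : nrm2 (x + y) = nrm2 x + nrm2 y + 2 * Re (inner x y).
Proof.
rewrite !nrm2_Re innerDl !innerDr [inner y x]innerC !cReD cRe_conj; ring.
Qed.

Lemma nrm2Z t x : nrm2 (t%:C%C *: x) = t ^+ 2 * nrm2 x.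
Proof. by rewrite !nrm2_Re innerZl innerZr conj_real !cReZ mulrA. Qed.

Lemma nrm20 : nrm2 (0 : l2 R I) = 0.
Proof. by rewrite nrm2_Re inner0l. Qed.

Lemma nrm2N x : nrm2 (- x) = nrm2 x.
Proof. by rewrite !nrm2_Re innerNl innerNr opprK. Qed.

Lemma Re_inner_le x y : 2 * Re (inner x y) <= nrm2 x + nrm2 y.
Proof.
by have := nrm2_ge0 (x - y); rewrite nrm2D nrm2N innerNr cReN; lra.
Qed.

Lemma nrm2_basis (j : I) : nrm2 (Defs.basis R j) = 1.
Proof. by rewrite nrm2_Re inner_bb eqxx. Qed.

(** The finitely supported vector with coordinates [c] on [X]; the coefficients
    need not be square-summable, so that [c] can also be the candidate for the
    coordinates of a vector not yet known to exist. *)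
Definition trunc (X : seq I) (c : I -> R[i]^o) : l2 R I :=
  \sum_(j <- X) (c j : R[i]) *: Defs.basis R j.

Lemma trunc_coord X c i : uniq X -> trunc X c i = if i \in X then c i else 0.
Proof.
move=> uX; rewrite -inner_basis inner_suml.
under eq_bigr do rewrite innerZl inner_bb.
case: ifPn => [iX|iX].
  rewrite (bigD1_seq i)//= eqxx mulr1 big1 ?addr0// => j /negPf ->.
  by rewrite mulr0.
rewrite big_seq big1// => j jX; case: eqP => [ji|_]; last by rewrite mulr0.
by rewrite -ji jX in iX.
Qed.

Lemma nrm2_trunc X c : uniq X -> nrm2 (trunc X c) = \sum_(j <- X) normc (c j) ^+ 2.
Proof.
move=> uX; rewrite nrm2_Re {1}/trunc inner_suml cRe_sum big_seq [RHS]big_seq.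
apply: eq_bigr => j jX.
rewrite innerZl inner_basisl trunc_coord// jX sqr_normcE.
by case: (c j) => a b /=; ring.
Qed.

(** Finitely supported vectors are dense. *)
Lemma trunc_dense x e : 0 < e ->
  exists2 X : seq I, uniq X & nrm2 (x - trunc X x) < e.
Proof.
move=> e0; have fx := l2_fin x.
have : (sqnorm x - e%:E < sqnorm x)%E by rewrite -(nrm2E x) -EFinB lte_fin; lra.
rewrite {2}/sqnorm /esum => /ereal_sup_gt[_ /= [A [finA _] <-]].
rewrite fsbig_finite//=; set Y := fset_set A; set X := finmap.enum_fset Y => H.
have uX : uniq X by exact: finmap.fset_uniq.
have XE i : (i \in X) = (i \in A) by rewrite -(in_fset_set finA).
exists X => //.
have n0 (i : I) (_ : [set: I] i) : (0 <= (normc (x i) ^+ 2)%:E)%E.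
  by rewrite lee_fin sqr_ge0.
have sx : sqnorm x = ((nrm2 (trunc X x))%:E + (nrm2 (x - trunc X x))%:E)%E.
  rewrite {1}/sqnorm (esumID A)//; congr (_ + _)%E.
    rewrite setTI esum_fset//.
      by rewrite fsbig_finite// nrm2_trunc// sumEFin.
    by move=> i _; exact: n0.
  rewrite nrm2E /sqnorm [RHS](esumID A)//; last first.
    by move=> i _; rewrite lee_fin sqr_ge0.
  rewrite [X in (X + _)%E]esum1 ?add0e; last first.
    move=> i [_ /mem_set iX]; have E : (x - trunc X x) i = x i - trunc X x i by [].
    by rewrite E trunc_coord// XE iX subrr normc0 expr0n.
  apply: eq_esum => i [_ niX]; have iX := memNset niX.
  have E : (x - trunc X x) i = x i - trunc X x i by [].
  by rewrite E trunc_coord// XE iX subr0.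
move: H; rewrite sumEFin -nrm2_trunc// sx.
by rewrite -!EFinD lte_fin; lra.
Qed.

End inner_theory.

(** * Riesz representation and adjoints *)

Section riesz.
Variables (R : realType) (I J : choiceType).
Notation Re := (@complex.Re R).

(** A bounded antilinear functional is determined by its values on the basis
    vectors. Boundedness is the one-sided quadratic estimate [K * (a + nrm2 w)],
    which is what positivity arguments provide directly. *)
Lemma antilinear_eq0 (D : l2 R J -> R[i]) (K a : R) : 0 < K -> 0 <= a ->
  (forall c u w, D (c *: u + w) = c^* * D u + D w) ->
  (forall w, Re (D w) <= K * (a + nrm2 w)) ->
  (forall j, D (Defs.basis R j) = 0) -> forall w, D w = 0.
Proof.
move=> K0 a0 linD bD D0.
have D00 : D 0 = 0.
  have /eqP := linD 1 0 0; rewrite scaler0 addr0 conjC1 mul1r.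
  by rewrite addrC -subr_eq subrr => /eqP <-.
have DZ c u : D (c *: u) = c^* * D u by rewrite -[c *: u]addr0 linD D00 addr0.
have DB u w : D (u - w) = D u - D w.
  by rewrite addrC -(scaleN1r w) linD conjCN1 mulN1r addrC.
have Dtr X w : D (trunc X w) = 0.
  rewrite /trunc; elim: X => [|j X IH]; rewrite ?big_nil// big_cons linD IH.
  by rewrite D0 mulr0 addr0.
have Dle w : Re (D w) <= 0.
  rewrite leNgt; apply/negP => d0; set d := Re (D w) in d0.
  (* Scaling by [s] beats the bound [K * (a + 1)], which holds as soon as the
     truncation error is below [1 / s ^ 2]. *)
  pose s := 2 * (K * (a + 1)) / d.
  have Ka0 : 0 < K * (a + 1) by rewrite mulr_gt0//; lra.
  have s0 : 0 < s by rewrite /s divr_gt0// mulr_gt0.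
  have [X uX nX] := trunc_dense w (eqbRL (invr_gt0 (s ^+ 2)) (exprn_gt0 2 s0)).
  have := bD (s%:C%C *: (w - trunc X w)).
  rewrite DZ DB Dtr subr0 conj_real cReZ -/d nrm2Z.
  have -> : s * d = 2 * (K * (a + 1)) by rewrite /s divfK// gt_eqF.
  have : s ^+ 2 * nrm2 (w - trunc X w) <= 1.
    by rewrite mulrC -ler_pdivlMr ?exprn_gt0// div1r ltW.
  move=> h1 h2; have : K * (a + s ^+ 2 * nrm2 (w - trunc X w)) <= K * (a + 1).
    by rewrite ler_pM2l// lerD2l.
  lra.
have DR w : Re (D w) = 0.
  apply/eqP; rewrite eq_le Dle/= -oppr_le0 -cReN.
  by have := Dle (- w); rewrite -(scaleN1r w) DZ conjCN1 mulN1r.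
move=> w; have := DR ('i *: w)%C; rewrite DZ; have := DR w.
rewrite conj_complexE; case: (D w) => x y /= ->.
by rewrite mul0r sub0r mulN1r opprK => ->.
Qed.

Variables (B : l2 R I -> l2 R J -> R[i]) (M : R).
Hypothesis M0 : 0 < M.
Hypothesis linl : forall c u v w, B (c *: u + v) w = c * B u w + B v w.
Hypothesis linr : forall c u v w, B v (c *: u + w) = c^* * B v u + B v w.
Hypothesis bB : forall v w, Re (B v w) <= M * (nrm2 v + nrm2 w).

(* The coordinates of the vector that represents [B v]. *)
Let coord v (j : J) : R[i]^o := B v (Defs.basis R j).

Let B0r v : B v 0 = 0.
Proof.
have /eqP := linr 1 0 v 0; rewrite scaler0 addr0 conjC1 mul1r.
by rewrite addrC -subr_eq subrr => /eqP <-.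
Qed.

(* Testing the bound on [v] and the multiple [1 / (2 M)] of the truncated
   coordinate vector bounds every finite partial sum. *)
Let coord_bound v : (sqnorm (coord v) <= (4 * M ^+ 2)%:E * sqnorm v)%E.
Proof.
rewrite -nrm2E -EFinM; apply: ge_ereal_sup => _ /= [A [finA _] <-].
rewrite fsbig_finite// sumEFin lee_fin.
set Y := fset_set A; set X := finmap.enum_fset Y.
have uX : uniq X by exact: finmap.fset_uniq.
set S := \sum_(j <- X) _.
pose w : l2 R J := trunc X (coord v).
have nw : nrm2 w = S by exact: nrm2_trunc.
have Bw : Re (B v w) = S.
  have -> : B v w = \sum_(j <- X) (coord v j : R[i])^* * coord v j.
    rewrite /w /trunc; elim: (X) => [|j X' IH]; first by rewrite !big_nil B0r.
    by rewrite !big_cons linr IH.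
  rewrite cRe_sum; apply: eq_bigr => j _; rewrite sqr_normcE.
  by case: (coord v j) => a b /=; ring.
have BZ t : Re (B v (t%:C%C *: w)) = t * S.
  by rewrite -[_ *: w]addr0 linr B0r addr0 conj_real cReZ Bw.
have := bB v ((2 * M)^-1%:C%C *: w); rewrite BZ nrm2Z nw => h.
have : (2 * M) * ((2 * M)^-1 * S) <= 2 * M * (M * (nrm2 v + (2 * M)^-1 ^+ 2 * S)).
  by rewrite ler_pM2l// mulr_gt0.
have M2 : 2 * M != 0 by rewrite mulf_neq0// ?pnatr_eq0// gt_eqF.
rewrite mulVKf// => h2.
have E : 2 * M * (M * (nrm2 v + (2 * M)^-1 ^+ 2 * S)) = 2 * M ^+ 2 * nrm2 v + S / 2.
  by field; rewrite gt_eqF.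
rewrite E in h2; lra.
Qed.

Let coord_l2 v : coord v \in @sqsummable R J.
Proof.
rewrite inE; apply: le_lt_trans (coord_bound v) _.
by rewrite -nrm2E -EFinM ltry.
Qed.

Let T v : l2 R J := L2 (coord_l2 v).

Let T_op : T \in @bounded_linear R I J.
Proof.
apply/bounded_linearP; split.
  by move=> c u v; apply: l2_ext => j; rewrite l2PE /= /coord linl.
exists (4 * M ^+ 2); first by rewrite mulr_ge0// sqr_ge0.
exact: coord_bound.
Qed.

(** Riesz representation: a bounded sesquilinear form is the form of an
    operator. *)
Lemma form_op : exists E : op R I J, forall v w, inner (E v) w = B v w.
Proof.
exists (Op T_op) => v w.
apply/eqP; rewrite -subr_eq0; apply/eqP.
have n0 := nrm2_ge0.
apply: (@antilinear_eq0 (fun w => inner (T v) w - B v w) (M + 2) (nrm2 v + nrm2 (T v))) => //.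
- by move: M0; lra.
- by rewrite addr_ge0 ?nrm2_ge0.
- by move=> c u z; rewrite innerDr innerZr linr; ring.
- move=> z; rewrite cReD cReN.
  have BN : Re (B v (- z)) = - Re (B v z).
    by rewrite -[- z]addr0 -(scaleN1r z) linr B0r addr0 conjCN1 mulN1r cReN.
  have := bB v (- z); rewrite BN nrm2N => h1.
  have h2 := Re_inner_le (T v) z.
  have := mulr_ge0 (ltW M0) (n0 _ _ (T v)); have := n0 _ _ v; have := n0 _ _ (T v).
  have := n0 _ _ z; lra.
- by move=> j; rewrite inner_basis /= subrr.
Qed.

End riesz.

Section adjoint.
Variables (R : realType).

Lemma op_nrm2 (I J : choiceType) (T : op R I J) :
  exists2 c : R, 0 <= c & forall x, nrm2 (T x) <= c * nrm2 x.
Proof.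
have [c c0 Tc] := op_bounded T; exists c => // x.
by rewrite -lee_fin EFinM !nrm2E.
Qed.

(** The form that represents the adjoint is [(y, x) |-> <y, T x>]. *)
Lemma adj_exists (I J : choiceType) (T : op R I J) : exists S, is_adjoint T S.
Proof.
have [c c0 Tc] := op_nrm2 T.
have [|d y z x|d y z x|y x|S HS] := @form_op R J I (fun y x => (inner (T x) y)^*) (1 + c).
- by rewrite ltr_pwDl.
- by rewrite innerDr innerZr rmorphD rmorphM /= conjCK.
- by rewrite linearP innerDl innerZl rmorphD rmorphM.
- rewrite cRe_conj; have := Re_inner_le (T x) y; have := Tc x.
  have := nrm2_ge0 y; have := nrm2_ge0 x.
  have := mulr_ge0 c0 (nrm2_ge0 y); have := mulr_ge0 c0 (nrm2_ge0 x); lra.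
by exists S => x y; rewrite [RHS]innerC HS conjCK.
Qed.

Lemma adjP (I J : choiceType) (T : op R I J) x y : inner (T x) y = inner x (adj T y).
Proof.
rewrite /adj; case: xgetP => [S _ HS|H]; first exact: HS.
by have [S /H] := adj_exists T.
Qed.

Lemma adjPr (I J : choiceType) (T : op R I J) x y : inner x (T y) = inner (adj T x) y.
Proof. by rewrite innerC adjP -innerC. Qed.

Lemma op_ext (I J : choiceType) (S T : op R I J) : (forall x, S x = T x) -> S = T.
Proof. by move=> ST; apply/val_inj/funext. Qed.

Lemma op_ext_inner (I J : choiceType) (S T : op R I J) :
  (forall x y, inner (S x) y = inner (T x) y) -> S = T.
Proof. by move=> ST; apply: op_ext => x; apply: inner_extr => y. Qed.

Lemma adj_unique (I J : choiceType) (T : op R I J) S : is_adjoint T S -> adj T = S.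
Proof.
by move=> TS; apply: op_ext => y; apply: inner_extl => x; rewrite -adjP TS.
Qed.

Lemma adjK (I J : choiceType) (T : op R I J) : adj (adj T) = T.
Proof. by apply: adj_unique => x y; rewrite -adjPr. Qed.

Lemma compressE (I J : choiceType) (a : op R I J) T x y :
  inner (compress a T x) y = inner (T (a x)) (a y).
Proof. by rewrite /= -adjPr. Qed.

Lemma opDE (I J : choiceType) (S T : op R I J) x : (S + T) x = S x + T x.
Proof. by []. Qed.

Lemma opNE (I J : choiceType) (T : op R I J) x : (- T) x = - T x.
Proof. by []. Qed.

Lemma opZE (I J : choiceType) c (T : op R I J) x : (c *: T) x = c *: T x.
Proof. by []. Qed.

Lemma op0E (I J : choiceType) x : (0 : op R I J) x = 0.
Proof. by []. Qed.

Lemma op_sumE (I J : choiceType) T (r : seq T) (P : pred T) (F : T -> op R I J) x :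
  (\sum_(i <- r | P i) F i) x = \sum_(i <- r | P i) F i x.
Proof. by apply: (big_morph (fun S : op R I J => S x)). Qed.

(** Polarization: over the complex numbers the quadratic form determines the
    operator. *)
Lemma polar_eq0 (I : choiceType) (T : op R I I) :
  (forall x, inner (T x) x = 0) -> T = 0.
Proof.
move=> T0; apply: op_ext_inner => x y; rewrite op0E inner0l.
have H u v : inner (T u) v + inner (T v) u = 0.
  by have := T0 (u + v); rewrite linearD innerDl !innerDr !T0 addr0 add0r.
have := H x y; have := H x ('i *: y); rewrite linearZ innerZr innerZl => h2 h1.
have {}h2 : inner (T y) x - inner (T x) y = 0.
  have /eqP : 'i * (inner (T y) x - inner (T x) y) = 0.
    by rewrite -h2 conjCi; ring.
  by rewrite mulf_eq0 (negPf (neq0Ci _)) /= => /eqP.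
have /eqP : 2 * inner (T x) y = 0.
  by rewrite -[RHS]h1 -[RHS]subr0 -{1}h2; ring.
by rewrite mulf_eq0 pnatr_eq0 /= => /eqP.
Qed.

Lemma selfadjointP (I : choiceType) (T : op R I I) :
  selfadjoint T <-> forall x y, inner (T x) y = inner x (T y).
Proof.
split => [Tsa x y|H]; first by rewrite adjP Tsa.
exact: adj_unique.
Qed.

Lemma op_pos_sa (I : choiceType) (T : op R I I) : op_pos T -> selfadjoint T.
Proof.
move=> Tp; apply/eqP; rewrite -subr_eq0; apply/eqP; apply: polar_eq0 => z.
rewrite opDE opNE innerBl -adjPr innerC.
by rewrite (CrealP (ger0_real (Tp z))) subrr.
Qed.

End adjoint.

(** * Tensor products with basis vectors, continuity of matrix coefficients *)

Section tensor.
Variables (R : realType) (K I : choiceType).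
Notation Re := (@complex.Re R).

(** Polarization: the inner product is recovered from the norm. *)
Lemma inner_isometry (L : choiceType) (T : op R I L) :
  (forall x, nrm2 (T x) = nrm2 x) -> forall x y, inner (T x) (T y) = inner x y.
Proof.
move=> iT x y.
have H u v : Re (inner (T u) (T v)) = Re (inner u v).
  by have := iT (u + v); rewrite linearD !nrm2D !iT; lra.
have := H x y; have := H x ('i%C *: y); rewrite linearZ !innerZr.
case: (inner (T x) (T y)) (inner x y) => [a b] [c d]; rewrite conj_complexE /=.
by rewrite !mul0r !sub0r !mulN1r !opprK => -> ->.
Qed.

Variable k : K.

Lemma ten_norm (f : I -> R[i]^o) :
  sqnorm (fun p : K * I => if p.1 == k then f p.2 else 0) = sqnorm f.
Proof.
rewrite sqnorm_prod (esumID [set k])//=; last by move=> ? _; exact: sqnorm_ge0.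
rewrite setTI esum_set1 ?sqnorm_ge0// eqxx setTI esum1 ?adde0// => k' /eqP.
move=> /negPf ->; rewrite /sqnorm esum1// => i _.
by rewrite normc0 expr0n.
Qed.

Lemma ten_val_subproof (x : l2 R I) :
  (fun p : K * I => if p.1 == k then x p.2 else 0) \in @sqsummable R (K * I)%type.
Proof. by rewrite inE ten_norm -ge0_fin_numE ?sqnorm_ge0 ?l2_fin. Qed.

Definition ten_val (x : l2 R I) : l2 R (K * I)%type := L2 (ten_val_subproof x).

Lemma ten_subproof : ten_val \in @bounded_linear R I (K * I)%type.
Proof.
apply/bounded_linearP; split; last first.
  by exists 1 => // x; rewrite mul1e /= ten_norm.
move=> a x y; apply: l2_ext => -[k' i]; rewrite l2PE /=.
by case: eqP => _; rewrite ?l2PE// mulr0 addr0.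
Qed.

(** [ten k x] is [e_k (x) x]. *)
Definition ten : op R I (K * I)%type := Op ten_subproof.

Lemma nrm2_ten x : nrm2 (ten x) = nrm2 x.
Proof. by rewrite /nrm2 /= ten_norm. Qed.

End tensor.

Arguments ten {R K I} k.

Section tensor_theory.
Variables (R : realType) (K : choiceType).

Lemma inner_ten (I : choiceType) (k l : K) (x y : l2 R I) :
  inner (ten k x) (ten l y) = (k == l)%:R * inner x y.
Proof.
case: eqP => [<-|/eqP kl]; rewrite ?mul1r ?mul0r.
  by apply: inner_isometry; exact: nrm2_ten.
rewrite -[RHS](inner0l (0 : l2 R (K * I)%type)); congr csum.
apply/funext => -[k' i] /=.
rewrite [RHS](_ : _ = 0); last by rewrite [X in X * _](_ : _ = 0)// mul0r.
case: eqP => [->|_]; last by rewrite mul0r.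
by rewrite (negPf kl) conjC0 mulr0.
Qed.

(** [1 (x) T] maps [e_k (x) x] to [e_k (x) T x]. *)
Lemma ampl_ten (I J : choiceType) (T : op R I J) (k : K) x :
  ampl K T (ten k x) = ten k (T x).
Proof.
apply: l2_ext => -[k' j] /=.
have -> : slice (ten k x) k' = if k' == k then x else 0.
  by apply: l2_ext => i /=; case: eqP.
by case: eqP => // _; rewrite linear0.
Qed.

Lemma ten_basis (I : choiceType) (k : K) (i : I) :
  ten k (Defs.basis R i) = Defs.basis R (k, i).
Proof.
by apply: l2_ext => -[k' i'] /=; rewrite xpair_eqE; case: eqP.
Qed.

Lemma ins_basis (I : choiceType) (k : K) (i : I) :
  ins R K i (Defs.basis R k) = Defs.basis R (k, i).
Proof.
apply: l2_ext => -[k' i'] /=; rewrite xpair_eqE andbC.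
by case: eqP.
Qed.

Lemma l2_sumE (I : choiceType) T (r : seq T) (P : pred T) (F : T -> l2 R I) i :
  (\sum_(t <- r | P t) F t) i = \sum_(t <- r | P t) F t i.
Proof. by apply: (big_morph (fun x : l2 R I => x i)). Qed.

End tensor_theory.

Section tensor_fin.
Variables (R : realType) (n : nat).

Lemma ten_decomp (I : choiceType) (v : l2 R ('I_n * I)%type) :
  v = \sum_(k < n) ten k (slice v k).
Proof.
apply: l2_ext => -[k i]; rewrite l2_sumE (bigD1 k)//= eqxx big1 ?addr0//.
by move=> j /negPf; rewrite eq_sym => ->.
Qed.

Lemma nrm2_slices (I : choiceType) (v : l2 R ('I_n * I)%type) :
  nrm2 v = \sum_(k < n) nrm2 (slice v k).
Proof.
rewrite nrm2_Re {1}[v]ten_decomp inner_suml cRe_sum; apply: eq_bigr => k _.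
rewrite {2}[v]ten_decomp inner_sumr (bigD1 k)//= inner_ten eqxx mul1r.
rewrite big1 ?addr0 ?nrm2_Re// => j /negPf jk.
by rewrite inner_ten eq_sym jk mul0r.
Qed.

Lemma l2_fin_decomp (x : l2 R 'I_n) : x = \sum_(i < n) x i *: Defs.basis R i.
Proof.
apply: l2_ext => k; rewrite -[RHS]inner_basis inner_suml (bigD1 k)//=.
rewrite innerZl inner_bb eqxx mulr1 big1 ?addr0// => i /negPf ik.
by rewrite innerZl inner_bb ik mulr0.
Qed.

End tensor_fin.

Section topology.
Variables (R : realType) (I J : choiceType).
Notation Re := (@complex.Re R).

Lemma Re_continuous : continuous (fun z : R[i]^o => Re z : R).
Proof.
move=> z; apply/(@cvgrPdist_lt _ _ _ _ (nbhs_filter (z : R[i]^o))) => e e0.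
have e0' : 0 < (e%:C%C : R[i]) by rewrite ltcR.
apply/(@nbhs_normP _ R[i]^o); exists e%:C%C => //= t h; rewrite -ltcR; apply: le_lt_trans h.
by rewrite -cReN -cReD; exact: normc_ge_Re.
Qed.

(** The matrix coefficients are continuous for the weak* topology. *)
Lemma op_Re_continuous (x : l2 R I) (y : l2 R J) :
  continuous (fun T : op R I J => Re (inner (T x) y)).
Proof.
have -> : (fun T : op R I J => Re (inner (T x) y)) =
    Re \o (fun f : {ptws _ -> R[i]^o} => f (ten (0%N : nat) x, ten (0%N : nat) y))
       \o @normal_functionals R I J.
  by apply/funext => T; rewrite /comp /normal_functionals ampl_ten inner_ten eqxx mul1r.
move=> T; apply: continuous_comp; last first.
  apply: continuous_comp; last exact: Re_continuous.
  exact: (@proj_continuous _ (fun=> R[i]^o)).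
exact: initial_continuous.
Qed.

End topology.

(** * Real parts of matrix coefficients, weak compactness *)

Section reform.
Variables (R : realType).
Notation Re := (@complex.Re R).

(** The real part of the matrix coefficient [<T x, y>]. As [y] varies over
    [y] and ['i *: y] it determines the coefficient, and it avoids complex
    limits and inequalities. *)
Definition reform (I J : choiceType) (T : op R I J) x y : R := Re (inner (T x) y).

Lemma reformD (I J : choiceType) (S T : op R I J) x y :
  reform (S + T) x y = reform S x y + reform T x y.
Proof. by rewrite /reform opDE innerDl cReD. Qed.

Lemma reformN (I J : choiceType) (T : op R I J) x y :
  reform (- T) x y = - reform T x y.
Proof. by rewrite /reform opNE innerNl cReN. Qed.

Lemma reform0 (I J : choiceType) x y : reform (0 : op R I J) x y = 0.
Proof. by rewrite /reform op0E inner0l. Qed.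

Lemma reform_addl (I J : choiceType) (T : op R I J) x y z :
  reform T (x + y) z = reform T x z + reform T y z.
Proof. by rewrite /reform linearD innerDl cReD. Qed.

Lemma reform_oppl (I J : choiceType) (T : op R I J) x z :
  reform T (- x) z = - reform T x z.
Proof. by rewrite /reform linearN innerNl cReN. Qed.

Lemma reform_addr (I J : choiceType) (T : op R I J) x y z :
  reform T z (x + y) = reform T z x + reform T z y.
Proof. by rewrite /reform innerDr cReD. Qed.

Lemma reform_oppr (I J : choiceType) (T : op R I J) x z :
  reform T z (- x) = - reform T z x.
Proof. by rewrite /reform innerNr cReN. Qed.

Lemma reform_sum (I J : choiceType) T (r : seq T) (P : pred T) (F : T -> op R I J) x y :
  reform (\sum_(i <- r | P i) F i) x y = \sum_(i <- r | P i) reform (F i) x y.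
Proof.
by apply: (big_morph (fun S => reform S x y)) => [S T'|]; rewrite ?reformD ?reform0.
Qed.

Lemma reform_compress (I J : choiceType) (a : op R I J) T x y :
  reform (compress a T) x y = reform T (a x) (a y).
Proof. by rewrite /reform compressE. Qed.

Lemma reform_ext (I J : choiceType) (S T : op R I J) :
  (forall x y, reform S x y = reform T x y) -> S = T.
Proof.
move=> ST; apply: op_ext_inner => x y; have := ST x y; have := ST x ('i%C *: y).
rewrite /reform !innerZr; case: (inner (S x) y) (inner (T x) y) => [a b] [c d].
rewrite conj_complexE /= !mul0r !sub0r !mulN1r !opprK => -> ->.
by [].
Qed.

Lemma reform_id (I : choiceType) (x y : l2 R I) : reform (idop R I) x y = Re (inner x y).
Proof. by []. Qed.

(** Self-adjointness is symmetry of the real part of the form. *)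
Lemma selfadjoint_reform (I : choiceType) (T : op R I I) :
  selfadjoint T <-> forall x y, reform T x y = reform T y x.
Proof.
split => [/selfadjointP H x y|H]; first by rewrite /reform H innerC cRe_conj.
apply: reform_ext => x y; rewrite H /reform -adjPr innerC cRe_conj.
by [].
Qed.

Lemma op_pos_reform (I : choiceType) (T : op R I I) :
  op_pos T <-> (forall x y, reform T x y = reform T y x) /\ (forall x, 0 <= reform T x x).
Proof.
split => [Tp|[Tsa Tp] x].
  by split; [apply/selfadjoint_reform/op_pos_sa|move=> x; apply: ge0_Re].
have /selfadjointP/(_ x x) := (selfadjoint_reform T).2 Tsa.
rewrite [RHS]innerC; move: (Tp x); rewrite lecE /reform.
case: (inner (T x) x) => a b; rewrite conj_complexE /= => -> [] Hb.
by rewrite andbT; apply/eqP; lra.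
Qed.

(** Polarized positivity: expand the form at [x - y]. *)
Lemma pos_reform_le (I : choiceType) (T : op R I I) x y : op_pos T ->
  2 * reform T x y <= reform T x x + reform T y y.
Proof.
move=> /op_pos_reform[Tsa Tp]; have := Tp (x - y).
rewrite reform_addl !reform_addr !reform_oppl !reform_oppr (Tsa y x); lra.
Qed.

Lemma pos_reform_sum (I : choiceType) (E : op R I I) m (u : 'I_m -> l2 R I) : op_pos E ->
  reform E (\sum_i u i) (\sum_i u i) <= m%:R * \sum_i reform E (u i) (u i).
Proof.
move=> Ep; rewrite {1}/reform linear_sum inner_suml cRe_sum.
under eq_bigr do rewrite inner_sumr cRe_sum.
apply: (@le_trans _ _ (\sum_(i < m) \sum_(j < m)
    2^-1 * (reform E (u i) (u i) + reform E (u j) (u j)))).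
  apply: ler_sum => i _; apply: ler_sum => j _.
  have := pos_reform_le (u i) (u j) Ep; rewrite /reform; lra.
under eq_bigr do rewrite -mulr_sumr big_split /= sumr_const card_ord.
rewrite -mulr_sumr big_split /= sumr_const card_ord sumrMnl -mulr_natl; lra.
Qed.

Lemma op_le_reform (I : choiceType) (S T : op R I I) : selfadjoint S -> selfadjoint T ->
  op_le S T <-> forall x, reform S x x <= reform T x x.
Proof.
move=> /selfadjoint_reform Ssa /selfadjoint_reform Tsa; rewrite /op_le op_pos_reform.
split => [[_ H] x|H]; first by have := H x; rewrite reformD reformN subr_ge0.
split => x => [y|]; rewrite !reformD !reformN ?subr_ge0//.
by rewrite Ssa Tsa.
Qed.

End reform.

Section limits.
Variables (R : realType).
Notation Re := (@complex.Re R).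

(** Convergence of all matrix coefficients. *)
Definition reform_cvg (A : Type) (U : set_system A) (I J : choiceType)
  (T : A -> op R I J) (S : op R I J) :=
  forall x y, (fun t => reform (T t) x y) @ U --> reform S x y.

Lemma cvg_reform (A : Type) (U : set_system A) {FU : Filter U} (I J : choiceType)
  (T : A -> op R I J) (S : op R I J) : T @ U --> S -> reform_cvg U T S.
Proof. by move=> TS x y; exact: (cvg_comp _ _ TS (@op_Re_continuous R I J x y S)). Qed.

Lemma cvg_ge0 (A : Type) (U : set_system A) {FU : ProperFilter U} (f : A -> R) (l : R) :
  f @ U --> l -> (\forall t \near U, 0 <= f t) -> 0 <= l.
Proof.
move=> fl f0; apply: (closed_cvg (fun x : R => 0 <= x) (@closed_ge R 0) _ _ fl).
exact: f0.
Qed.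

Lemma cvg_le_lim (A : Type) (U : set_system A) {FU : ProperFilter U} (f g : A -> R) (l m : R) :
  f @ U --> l -> g @ U --> m -> (\forall t \near U, f t <= g t) -> l <= m.
Proof.
move=> fl gm fg; rewrite -subr_ge0.
by apply: (cvg_ge0 (cvgB gm fl)); apply: filterS fg => t; rewrite subr_ge0.
Qed.

Lemma cvg_eq_lim (A : Type) (U : set_system A) {FU : ProperFilter U} (f g : A -> R) (l m : R) :
  f @ U --> l -> g @ U --> m -> (\forall t \near U, f t = g t) -> l = m.
Proof.
move=> fl gm fg; apply/eqP; rewrite eq_le; apply/andP; split.
  by apply: (cvg_le_lim fl gm); apply: filterS fg => t ->.
by apply: (cvg_le_lim gm fl); apply: filterS fg => t ->.
Qed.

(** Positivity passes to limits of matrix coefficients. *)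
Lemma op_pos_lim (A : Type) (U : set_system A) {FU : ProperFilter U} (I : choiceType)
  (T : A -> op R I I) S : reform_cvg U T S -> (\forall t \near U, op_pos (T t)) -> op_pos S.
Proof.
move=> TS Tp; apply/op_pos_reform; split => [x y|x].
  apply: (cvg_eq_lim (TS x y) (TS y x)).
  by apply: filterS Tp => t /op_pos_reform[].
by apply: (cvg_ge0 (TS x x)); apply: filterS Tp => t /op_pos_reform[].
Qed.

Lemma ultra_fmap (A B : Type) (f : A -> B) (U : set_system A) :
  UltraFilter U -> UltraFilter (f @ U).
Proof.
move=> FU; have PU : ProperFilter U by exact: ultra_proper.
split => [|G PG UG]; first exact: fmap_proper_filter.
apply/seteqP; split => // X GX.
have [//|nX] := in_ultra_setVsetC (f @^-1` X) FU.
have : G (X `&` ~` X) by apply: filterI => //; exact: UG.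
by rewrite setICr => /filter_not_empty.
Qed.

(** Weak compactness of the set of positive operators bounded by [M]: along an
    ultrafilter all matrix coefficients converge, by compactness of real
    intervals, and the limiting form is represented by an operator. *)
Lemma pos_ultra_lim (A : Type) (U : set_system A) {FU : UltraFilter U} (I : choiceType)
    (E : A -> op R I I) (M : R) : 0 < M ->
  (\forall t \near U, op_pos (E t) /\ forall v, reform (E t) v v <= M * nrm2 v) ->
  exists E0, reform_cvg U E E0.
Proof.
move=> M0 UE; pose good t := op_pos (E t) /\ forall v, reform (E t) v v <= M * nrm2 v.
have PU : ProperFilter U by exact: ultra_proper.
have bd t v w : good t -> 2 * reform (E t) v w <= M * (nrm2 v + nrm2 w).
  move=> [Ep EM].
  by have := pos_reform_le v w Ep; have := EM v; have := EM w; lra.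
have bdN t v w : good t -> - (M * (nrm2 v + nrm2 w)) <= 2 * reform (E t) v w.
  by move=> /(bd _ v (- w)); rewrite nrm2N reform_oppr; lra.
have Lex v w : exists l : R, (fun t => reform (E t) v w) @ U --> l.
  set K := M * (nrm2 v + nrm2 w).
  have := @segment_compact R (- K) K; rewrite compact_ultra => cK.
  have [|l [_ ?]] := cK ((fun t => reform (E t) v w) @ U) (ultra_fmap _ FU).
    apply: (filterS _ UE) => t gt /=; rewrite in_itv /=.
    have := bd t v w gt; have := bdN t v w gt; rewrite -/K => h1 h2.
    have K0 : 0 <= K := mulr_ge0 (ltW M0) (addr_ge0 (nrm2_ge0 v) (nrm2_ge0 w)).
    by apply/andP; split; lra.
  by exists l.
pose L v w := xget 0 [set l : R | (fun t => reform (E t) v w) @ U --> l].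
have LP v w : (fun t => reform (E t) v w) @ U --> L v w.
  have [l Hl] := Lex v w.
  exact: (@xgetPex _ 0 [set l : R | (fun t => reform (E t) v w) @ U --> l] (ex_intro _ l Hl)).
have Lcomb v0 w0 v1 w1 v2 w2 v3 w3 (c d : R) :
    (forall t, reform (E t) v0 w0 = c * reform (E t) v1 w1 + d * reform (E t) v2 w2
       + reform (E t) v3 w3) -> L v0 w0 = c * L v1 w1 + d * L v2 w2 + L v3 w3.
  move=> H.
  have H' : (fun t => reform (E t) v0 w0) @ U --> c * L v1 w1 + d * L v2 w2 + L v3 w3.
    by rewrite (funext H); apply: cvgD; [apply: cvgD; apply: cvgMr|]; exact: LP.
  exact: (cvg_unique _ (LP v0 w0) H').
(* The imaginary part of a coefficient is the real part at ['i *: w]. *)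
pose B v w : R[i] := (L v w +i* L v ('i%C *: w))%C.
have iE t u w : reform (E t) u ('i%C *: w) = complex.Im (inner (E t u) w).
  rewrite /reform innerZr; case: (inner _ _) => a b; rewrite conj_complexE /=.
  by rewrite mul0r sub0r mulN1r opprK.
have cE (c z : R[i]) : Re (c * z) = Re c * Re z - complex.Im c * complex.Im z.
  by case: c z => [? ?] [? ?].
have cI (c z : R[i]) : complex.Im (c * z) = Re c * complex.Im z + complex.Im c * Re z.
  by case: c z => [? ?] [? ?] /=; rewrite addrC.
have ImD (u z : R[i]) : complex.Im (u + z) = complex.Im u + complex.Im z.
  by case: u z => [? ?] [? ?].
have Rconj (c : R[i]) : Re c^* = Re c by rewrite cRe_conj.
have Iconj (c : R[i]) : complex.Im c^* = - complex.Im c by case: c.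
have [|c u v w|c u v w|v w|E0 HE] := @form_op R I I B M => //.
- apply/eqP; rewrite eq_complex cReD ImD cE cI /=; apply/andP; split; apply/eqP.
    rewrite -mulNr; apply: Lcomb => t; rewrite iE mulNr.
    by rewrite /reform linearP innerDl innerZl cReD cE.
  apply: Lcomb => t; rewrite !iE.
  by rewrite linearP innerDl innerZl ImD cI.
- apply/eqP; rewrite eq_complex cReD ImD cE cI Rconj Iconj /=; apply/andP; split; apply/eqP.
    rewrite mulNr opprK; apply: Lcomb => t; rewrite iE.
    by rewrite /reform innerDr innerZr cReD cE Rconj Iconj mulNr opprK.
  apply: Lcomb => t; rewrite !iE.
  by rewrite innerDr innerZr ImD cI Rconj Iconj.
- rewrite /=; have : 2 * L v w <= M * (nrm2 v + nrm2 w).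
    apply: (@cvg_le_lim _ U _ (fun t => 2 * reform (E t) v w) (fun=> M * (nrm2 v + nrm2 w))).
    + by apply: cvgMr; exact: LP.
    + exact: cvg_cst.
    + by apply: (filterS _ UE) => t; exact: bd.
  have := mulr_ge0 (ltW M0) (addr_ge0 (nrm2_ge0 v) (nrm2_ge0 w)); lra.
exists E0 => v w; rewrite /reform HE /=; exact: LP.
Qed.

End limits.

(** * The closed ball and the cone of admissible block operators *)

Section pos.
Variables (R : realType).

Lemma op_pos0 (I : choiceType) : op_pos (0 : op R I I).
Proof. by move=> x; rewrite op0E inner0l. Qed.

Lemma op_posD (I : choiceType) (S T : op R I I) : op_pos S -> op_pos T -> op_pos (S + T).
Proof. by move=> Sp Tp x; rewrite opDE innerDl addr_ge0. Qed.

Lemma op_pos_sum (I : choiceType) T (r : seq T) (P : pred T) (F : T -> op R I I) :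
  (forall i, P i -> op_pos (F i)) -> op_pos (\sum_(i <- r | P i) F i).
Proof.
by move=> Fp; apply: (big_ind (@op_pos R I)) => //; [exact: op_pos0|exact: op_posD].
Qed.

Lemma op_pos_compress (I J : choiceType) (a : op R I J) T :
  op_pos T -> op_pos (compress a T).
Proof. by move=> Tp x; rewrite compressE. Qed.

Lemma innerxx_ge0 (I : choiceType) (x : l2 R I) : 0 <= inner x x.
Proof. by rewrite innerxx lecR nrm2_ge0. Qed.

Lemma op_pos_id (I : choiceType) : op_pos (idop R I).
Proof. by move=> x; exact: innerxx_ge0. Qed.

Lemma opcompE (I J L : choiceType) (S : op R J L) (T : op R I J) x :
  opcomp S T x = S (T x).
Proof. by []. Qed.

Lemma op_pos_mul_adj (I J : choiceType) (a : op R I J) : op_pos (opcomp a (adj a)).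
Proof. by move=> x; rewrite opcompE adjP; exact: innerxx_ge0. Qed.

Lemma reform_mul_adj (I J : choiceType) (a : op R I J) x y :
  reform (opcomp a (adj a)) x y = complex.Re (inner (adj a x) (adj a y)).
Proof. by rewrite /reform opcompE adjP. Qed.

Lemma op_posZ (I : choiceType) (c : R) (T : op R I I) : 0 <= c -> op_pos T ->
  op_pos (c%:C%C *: T).
Proof. by move=> c0 Tp x; rewrite opZE innerZl mulr_ge0// lecR. Qed.

Lemma reformZ (I J : choiceType) (c : R) (T : op R I J) x y :
  reform (c%:C%C *: T) x y = c * reform T x y.
Proof. by rewrite /reform opZE innerZl cReZ. Qed.

(** The closed ball is cut out by conditions that are affine in the tuple. *)
Lemma ballP (I : choiceType) k (x : 'I_k -> op R I I) (r : R) :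
  op_le (\sum_j opcomp (x j) (adj (x j))) ((r ^+ 2)%:C%C *: idop R I) <->
  forall (xi : l2 R I) (eta : 'I_k -> l2 R I),
    2 * (\sum_j reform (x j) (eta j) xi) <= r ^+ 2 * nrm2 xi + \sum_j nrm2 (eta j).
Proof.
rewrite op_le_reform; last 2 first.
- by apply/op_pos_sa/op_pos_sum => i _; exact: op_pos_mul_adj.
- by apply/op_pos_sa/op_posZ; [exact: sqr_ge0|exact: op_pos_id].
split => [H xi eta|H xi]; last first.
  rewrite reformZ reform_id -nrm2_Re reform_sum.
  under eq_bigr do rewrite reform_mul_adj -nrm2_Re.
  have := H xi (fun j => adj (x j) xi).
  rewrite (eq_bigr (fun j => nrm2 (adj (x j) xi))) => [|j _]; first by lra.
  by rewrite /reform adjP -nrm2_Re.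
have := H xi; rewrite reformZ reform_id -nrm2_Re reform_sum => {}H.
apply: (@le_trans _ _ (\sum_j nrm2 (adj (x j) xi) + \sum_j nrm2 (eta j))).
  rewrite mulr_sumr -big_split /=; apply: ler_sum => j _.
  by rewrite /reform adjP addrC; exact: Re_inner_le.
rewrite lerD2r; apply: le_trans H; apply: ler_sum => j _.
by rewrite reform_mul_adj nrm2_Re.
Qed.

Lemma cvg_finsum (A T : Type) (U : set_system A) {FU : Filter U} (s : seq T)
    (f : T -> A -> R) (l : T -> R) : (forall j, f j @ U --> l j) ->
  (fun t => \sum_(j <- s) f j t) @ U --> \sum_(j <- s) l j.
Proof.
move=> fl; elim: s => [|j s IH].
  by rewrite big_nil; under eq_fun do rewrite big_nil; exact: cvg_cst.
by rewrite big_cons; under eq_fun do rewrite big_cons; apply: cvgD.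
Qed.

Lemma ball_lim (A : Type) (U : set_system A) {FU : ProperFilter U} (I : choiceType) k
    (x : A -> 'I_k -> op R I I) y r :
  (forall j, reform_cvg U (fun t => x t j) (y j)) ->
  (\forall t \near U, op_le (\sum_j opcomp (x t j) (adj (x t j))) ((r ^+ 2)%:C%C *: idop R I)) ->
  op_le (\sum_j opcomp (y j) (adj (y j))) ((r ^+ 2)%:C%C *: idop R I).
Proof.
move=> xy xball; apply/ballP => xi eta.
apply: (@cvg_le_lim _ _ U _ (fun t => 2 * (\sum_j reform (x t j) (eta j) xi))
  (fun=> r ^+ 2 * nrm2 xi + \sum_j nrm2 (eta j))).
- by apply: cvgMr; apply: cvg_finsum => j; exact: xy.
- exact: cvg_cst.
- by apply: filterS xball => t /ballP.
Qed.

End pos.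

Section cone.
Variables (R : realType) (n k : nat) (bc : 'I_k -> 'I_n -> 'I_n -> R[i]) (lam : R).

(** The Choi blocks are indexed by [slot j]; the remaining index [ord0] carries
    the penalty block. *)
Definition slot (j : 'I_n) : 'I_n.+1 := lift ord0 j.

(** The real part of the quadratic form, at [xi], of the image of the matrix
    [bc i] under the map whose Choi blocks are those of [E], where [bc i j l] is
    the entry of this matrix in row [j] and column [l]. *)
Definition choi (I : choiceType) (E : op R ('I_n.+1 * I)%type ('I_n.+1 * I)%type) i xi :=
  \sum_j \sum_l reform E (ten (slot l) xi) (ten (slot j) ((bc i j l)^* *: xi)).

(** Block operators [E] on [C^(n+1) (x) l2 I] such that [E >= 0], the map
    [Psi] given by the Choi blocks of [E] sends [1] to [W], and the penalty block
    is at most [lam W] and dominates [+/- Re (x i - Psi (bc i))]. With [W] left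
    free, the conditions on [(x, W, E)] define a convex cone, stable under
    compressions and limits. *)
Definition cone (I : choiceType) (x : 'I_k -> op R I I) (W : op R I I)
    (E : op R ('I_n.+1 * I)%type ('I_n.+1 * I)%type) :=
  [/\ op_pos E,
      forall xi eta, \sum_j reform E (ten (slot j) xi) (ten (slot j) eta) = reform W xi eta,
      forall xi, reform E (ten ord0 xi) (ten ord0 xi) <= lam * reform W xi xi
    & forall i xi, `|reform (x i) xi xi - choi E i xi| <= reform E (ten ord0 xi) (ten ord0 xi)].

Lemma cone0 (I : choiceType) : @cone I (fun=> 0) 0 0.
Proof.
split => [|xi eta|xi|i xi].
- exact: op_pos0.
- by rewrite reform0 big1// => j _; rewrite reform0.
- by rewrite !reform0 mulr0.
- rewrite !reform0 /choi big1 ?subrr ?normr0// => j _.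
  by rewrite big1// => l _; rewrite reform0.
Qed.

Lemma coneD (I : choiceType) x1 x2 W1 W2 E1 E2 : @cone I x1 W1 E1 -> @cone I x2 W2 E2 ->
  cone (fun i => x1 i + x2 i) (W1 + W2) (E1 + E2).
Proof.
move=> [p1 s1 l1 c1] [p2 s2 l2 c2]; split => [|xi eta|xi|i xi].
- exact: op_posD.
- by under eq_bigr do rewrite reformD; rewrite big_split /= s1 s2 reformD.
- by rewrite !reformD mulrDr lerD.
- rewrite !reformD; have -> : choi (E1 + E2) i xi = choi E1 i xi + choi E2 i xi.
    rewrite /choi -big_split /=; apply: eq_bigr => j _.
    by rewrite -big_split /=; apply: eq_bigr => l _; rewrite reformD.
  rewrite opprD addrACA; apply: (le_trans (ler_normD _ _)).
  by rewrite lerD.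
Qed.

Lemma cone_compress (I J : choiceType) (a : op R I J) x W E : cone x W E ->
  cone (fun i => compress a (x i)) (compress a W) (compress (ampl 'I_n.+1 a) E).
Proof.
move=> [p s l c]; split => [|xi eta|xi|i xi].
- exact: op_pos_compress.
- rewrite reform_compress -s; apply: eq_bigr => j _.
  by rewrite reform_compress !ampl_ten.
- by rewrite !reform_compress !ampl_ten.
- rewrite !reform_compress !ampl_ten.
  have -> : choi (compress (ampl 'I_n.+1 a) E) i xi = choi E i (a xi).
    rewrite /choi; apply: eq_bigr => j _; apply: eq_bigr => m _.
    by rewrite reform_compress !ampl_ten linearZ.
  exact: c.
Qed.

Lemma cone_lim (A : Type) (U : set_system A) {FU : ProperFilter U} (I : choiceType)
    (x : A -> 'I_k -> op R I I) (W : A -> op R I I) E y V Z :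
  (forall j, reform_cvg U (fun t => x t j) (y j)) -> reform_cvg U W V ->
  reform_cvg U E Z -> (\forall t \near U, cone (x t) (W t) (E t)) -> cone y V Z.
Proof.
move=> xy WV EZ co; split => [|xi eta|xi|i xi].
- by apply: (op_pos_lim EZ); apply: filterS co => t [].
- apply: (@cvg_eq_lim _ _ U _
    (fun t => \sum_j reform (E t) (ten (slot j) xi) (ten (slot j) eta))
    (fun t => reform (W t) xi eta)).
  + by apply: cvg_finsum => j; exact: EZ.
  + exact: WV.
  + by apply: filterS co => t [].
- apply: (@cvg_le_lim _ _ U _ (fun t => reform (E t) (ten ord0 xi) (ten ord0 xi))
    (fun t => lam * reform (W t) xi xi)).
  + exact: EZ.
  + by apply: cvgMr; exact: WV.
  + by apply: filterS co => t [].
- apply: (@cvg_le_lim _ _ U _ (fun t => `|reform (x t i) xi xi - choi (E t) i xi|)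
    (fun t => reform (E t) (ten ord0 xi) (ten ord0 xi))).
  + apply: cvg_norm; apply: cvgB; first exact: xy.
    by apply: cvg_finsum => j; apply: cvg_finsum => l; exact: EZ.
  + exact: EZ.
  + by apply: filterS co => t [].
Qed.

(** A positive block operator is bounded by the number of blocks times the sum
    of its diagonal blocks. *)
Lemma cone_bound (I : choiceType) x W E : @cone I x W E -> 0 <= lam ->
  (forall xi, reform W xi xi <= nrm2 xi) ->
  forall v, reform E v v <= n.+1%:R * (1 + lam) * nrm2 v.
Proof.
move=> [p s l c] lam0 W1 v; rewrite {1 2}[v]ten_decomp.
apply: (le_trans (pos_reform_sum _ p)).
rewrite -mulrA ler_wpM2l// nrm2_slices mulr_sumr; apply: ler_sum => j _.
have q0 u : 0 <= reform E u u by have /op_pos_reform[_] := p; apply.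
have n0 := nrm2_ge0 (slice v j).
have [j' ->|->] := unliftP ord0 j; last first.
  apply: (le_trans (l _)); rewrite mulrDl mul1r.
  by apply: (@le_trans _ _ (lam * nrm2 (slice v ord0))); [rewrite ler_wpM2l|rewrite lerDr nrm2_ge0].
apply: (@le_trans _ _ (nrm2 (slice v (slot j')))); last first.
  by rewrite mulrDl mul1r lerDl mulr_ge0// nrm2_ge0.
apply: le_trans (W1 _); rewrite -s (bigD1 j')//= lerDl sumr_ge0//.
Qed.

End cone.

(** * The test majorization function *)

Section diag.
Variables (R : realType) (m : nat) (I : choiceType).

Lemma adj_ten (k l : 'I_m) (x : l2 R I) : adj (ten k) (ten l x) = (k == l)%:R *: x.
Proof.
apply: inner_extl => z; rewrite -adjP inner_ten innerZr.
by case: eqP => _; rewrite ?conjC1 ?conjC0.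
Qed.

(** The operator [d (x) 1] for a diagonal matrix [d]. *)
Lemma diag_op (d : 'I_m -> R) : (forall k, 0 <= d k) ->
  exists2 E : op R ('I_m * I)%type ('I_m * I)%type, op_pos E &
    forall j l xi eta, reform E (ten l xi) (ten j eta) =
      (l == j)%:R * d l * complex.Re (inner xi eta).
Proof.
move=> d0; exists (\sum_k (d k)%:C%C *: opcomp (ten k) (adj (ten k))).
  by apply: op_pos_sum => k _; apply: op_posZ => //; exact: op_pos_mul_adj.
move=> j l xi eta; rewrite reform_sum (bigD1 l)//= big1 ?addr0 => [|k kl].
  rewrite reformZ reform_mul_adj !adj_ten eqxx scale1r innerZr.
  by case: eqP => _; rewrite ?conjC1 ?conjC0 ?mul1r ?mul0r ?mulr0.
rewrite reformZ reform_mul_adj !adj_ten (negPf kl) scale0r inner0l.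
by rewrite mulr0.
Qed.

End diag.

Section compress_theory.
Variables (R : realType).

Lemma compressB (I J : choiceType) (a : op R I J) S T :
  compress a (S - T) = compress a S - compress a T.
Proof.
by apply: reform_ext => x y; rewrite reformD reformN !reform_compress reformD reformN.
Qed.

Lemma op_le_compress (I J : choiceType) (a : op R I J) S T :
  op_le S T -> op_le (compress a S) (compress a T).
Proof. by rewrite /op_le -compressB; exact: op_pos_compress. Qed.

Lemma compress_isometry (I J : choiceType) (a : op R I J) :
  opcomp (adj a) a = idop R I -> compress a (idop R J) = idop R I.
Proof. by move=> <-; apply: op_ext. Qed.

Lemma ampl_comp (K I J L : choiceType) (S : op R J L) (T : op R I J) x :
  ampl K S (ampl K T x) = ampl K (opcomp S T) x.
Proof.
apply: l2_ext => -[k i] /=; congr (S _ i).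
by apply: l2_ext.
Qed.

Lemma ampl_id (K I : choiceType) x : ampl K (idop R I) x = x.
Proof. by apply: l2_ext => -[k i]. Qed.

Lemma reform_series (I J : choiceType) (u : nat -> op R I J) N x y :
  reform (series u N) x y = \sum_(0 <= i < N) reform (u i) x y.
Proof. by rewrite /series /= reform_sum. Qed.

(** The form of a positive operator bounds its norm. *)
Lemma opnorm_le (I : choiceType) (E : op R I I) (M : R) : 0 < M -> op_pos E ->
  (forall v, reform E v v <= M * nrm2 v) -> opnorm E <= M.
Proof.
move=> M0 Ep EM; apply: ge_sup.
  by exists (l2norm (E 0)), 0 => //; rewrite /= /l2norm -/(nrm2 0) nrm20 sqrtr0.
move=> _ [v /= v1 <-].
have v1' : nrm2 v <= 1 by rewrite -l2norm_sqr expr_le1// sqrtr_ge0.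
rewrite -(ler_pXn2r (n := 2))// ?nnegrE ?sqrtr_ge0 ?(ltW M0)// l2norm_sqr.
(* The choice of [M^-1] optimizes the bound in the parameter [t] of the
   polarized inequality at [v] and [t *: E v]. *)
have := pos_reform_le v ((M^-1)%:C%C *: E v) Ep.
have := EM ((M^-1)%:C%C *: E v).
rewrite nrm2Z {2}/reform innerZr conj_real cReZ -nrm2_Re.
have := EM v => h1 h2 h3.
have h4 : 2 * (M^-1 * nrm2 (E v)) <= M * nrm2 v + M * (M^-1 ^+ 2 * nrm2 (E v)) by lra.
have h5 : M * (M^-1 ^+ 2 * nrm2 (E v)) = M^-1 * nrm2 (E v).
  by field; rewrite gt_eqF.
have h6 : M^-1 * nrm2 (E v) <= M * nrm2 v by rewrite h5 in h4; lra.
have : M * (M^-1 * nrm2 (E v)) <= M * (M * nrm2 v) by rewrite ler_pM2l.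
rewrite mulVKf ?gt_eqF// => /le_trans; apply.
by rewrite mulrA -expr2 ler_piMr// sqr_ge0.
Qed.

End compress_theory.

Section majfun.
Variables (R : realType) (n k : nat) (n_gt0 : (0 < n)%N).
Variables (bc : 'I_k -> 'I_n -> 'I_n -> R[i]) (r : R).

(* The value on [bc i] of the normalized trace, real part. *)
Let tb i := n%:R^-1 * \sum_j complex.Re (bc i j j).

(** A bound on the penalty block which leaves room, for every [x] in the ball,
    for the map [Psi] that sends a matrix to its normalized trace. *)
Definition penalty_bound : R := r ^+ 2 + 1 + \sum_i `|tb i|.

Notation lam := penalty_bound.

Lemma penalty_bound_ge0 : 0 <= lam.
Proof. by rewrite !addr_ge0// ?sqr_ge0// sumr_ge0. Qed.

(** The dimension [n + 1]. *)
Definition majdim : Defs.dim := Fin (ltn0Sn n).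

(** The test function: the operators that dominate an admissible block
    operator. *)
Definition majfun (m : Defs.dim) (x : 'I_k -> M R m m) : set (MpM R majdim m) :=
  [set T | exists2 E : MpM R majdim m, cone bc lam x (idop R (idx m)) E & op_le E T].

Lemma majfun_neq0 m (x : 'I_k -> M R m m) : nc_ball r x -> majfun x !=set0.
Proof.
move=> /ballP xb.
(* The blocks of the normalized trace, and the largest allowed penalty. *)
pose d (j : 'I_n.+1) := if j == ord0 then lam else n%:R^-1 : R.
have nV0 : 0 <= (n%:R^-1 : R) by rewrite invr_ge0.
have d0 j : 0 <= d j by rewrite /d; case: ifP => // _; exact: penalty_bound_ge0.
have [E Ep HE] := @diag_op R n.+1 (idx m) d d0.
exists E, E; last by move=> z; rewrite subrr op0E inner0l.
have ds j : d (slot j) = n%:R^-1 by rewrite /d /slot -(inj_eq val_inj).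
split => // [xi eta|xi|i xi].
- under eq_bigr do rewrite HE eqxx mul1r ds.
  rewrite sumr_const card_ord -mulrnAl -mulr_natl mulfV ?mul1r//.
  by rewrite pnatr_eq0 -lt0n.
- by rewrite HE !eqxx mul1r /d eqxx reform_id.
- rewrite HE !eqxx mul1r {1}/d eqxx -nrm2_Re.
  have -> : choi bc E i xi = tb i * nrm2 xi.
    rewrite /choi /tb -mulrA mulr_suml mulr_sumr; apply: eq_bigr => j _.
    have Rec (c : R[i]) : complex.Re (inner xi (c^* *: xi)) = complex.Re c * nrm2 xi.
      by rewrite innerZr conjCK innerxx; case: c => u v /=; rewrite mulr0 subr0.
    rewrite (bigD1 j)//= HE eqxx mul1r ds Rec big1 ?addr0//.
    move=> l lj; rewrite HE (inj_eq (@lift_inj _ _)) (negPf lj) mulr0n.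
    by rewrite !mul0r.
  apply: (le_trans (ler_normB _ _)).
  rewrite [lam * _]mulrDl lerD//; last first.
    rewrite normrM (ger0_norm (nrm2_ge0 xi)) ler_wpM2r ?nrm2_ge0//.
    by rewrite (bigD1 i)//= lerDl sumr_ge0.
  have xb1 (s : R) : s ^+ 2 = 1 -> 2 * (s * reform (x i) xi xi) <= r ^+ 2 * nrm2 xi + nrm2 xi.
    move=> s1; have := xb xi (fun j => if j == i then s%:C%C *: xi else 0).
    rewrite (bigD1 i)//= eqxx big1 ?addr0 => [|j /negPf ji]; last first.
      by rewrite ji /reform linear0 inner0l.
    rewrite (bigD1 i)//= eqxx [X in _ + (_ + X)]big1 ?addr0 => [|j /negPf ji]; last first.
      by rewrite ji nrm20.
    by rewrite nrm2Z s1 mul1r /reform linearZ innerZl cReZ.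
  have := xb1 1 (expr1n _ _); have := xb1 (-1) (etrans (sqrrN 1) (expr1n _ 2)).
  have := nrm2_ge0 xi; have := mulr_ge0 (sqr_ge0 r) (nrm2_ge0 xi).
  by rewrite ler_norml mulrDl => *; apply/andP; split; lra.
Qed.

Lemma majfun_pos m (x : 'I_k -> M R m m) T : majfun x T -> op_pos T.
Proof.
move=> [E [Ep _ _ _] ET].
by have := op_posD ET Ep; rewrite subrK.
Qed.

Lemma majfun_up m (x : 'I_k -> M R m m) T P :
  majfun x T -> op_pos P -> majfun x (T + P).
Proof.
move=> [E Ec ET] Pp; exists E; first exact: Ec.
by rewrite /op_le addrAC; exact: op_posD.
Qed.

Lemma majfun_compress m (x : 'I_k -> M R m m) T (a : M R m m) : unitary a ->
  majfun x T -> majfun (fun j => compress a (x j)) (compress (id_tensor majdim a) T).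
Proof.
move=> [aa _] [E Ec ET]; exists (compress (ampl 'I_n.+1 a) E).
  by rewrite -(compress_isometry aa); exact: cone_compress.
exact: op_le_compress.
Qed.

Lemma majfun_multivalued : multivalued_nc r majfun.
Proof.
move=> m x xb; split.
- exact: majfun_neq0.
- by move=> T /majfun_pos/op_pos_sa.
- move=> a ua; apply/seteqP; split => [T FT|_ [T FT <-]]; last exact: majfun_compress.
  have [aa aa'] := ua.
  have ua' : unitary (adj a) by split; rewrite adjK.
  exists (compress (id_tensor majdim (adj a)) T).
    have := majfun_compress ua' FT; congr (majfun _ _).
    apply/funext => j; apply: reform_ext => u v; rewrite !reform_compress.
    by rewrite -!(opcompE a (adj a)) aa'.
  apply: reform_ext => u v; rewrite !reform_compress.
  by rewrite !ampl_comp aa !ampl_id.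
- apply/seteqP; split => [T FT|_ [T FT [P Pp <-]]]; last exact: majfun_up.
  exists T; first exact: FT.
  by exists 0; [exact: op_pos0|rewrite addr0].
Qed.

(** A common norm bound on the admissible block operators. *)
Definition maj_bound : R := n.+1%:R * (1 + lam).

Lemma maj_bound_gt0 : 0 < maj_bound.
Proof. by rewrite mulr_gt0// ltr_pwDl// penalty_bound_ge0. Qed.

Lemma majfun_bounded : bounded_nc r majfun.
Proof.
exists maj_bound; first exact: maj_bound_gt0.
move=> m x xb T [E Ec ET]; exists E; split; [|exact: ET|].
  by exists E; [exact: Ec|move=> z; rewrite subrr op0E inner0l].
have [Ep _ _ _] := Ec; apply: opnorm_le => //; first exact: maj_bound_gt0.
apply: (cone_bound Ec); first exact: penalty_bound_ge0.
by move=> xi; rewrite reform_id -nrm2_Re.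
Qed.

(** The graph is stable under limits of all matrix coefficients, by weak
    compactness of the set of admissible [E]. *)
Lemma majfun_lim (A : Type) (U : set_system A) {FU : UltraFilter U} m
    (x : A -> 'I_k -> M R m m) (W : A -> M R m m) (E T : A -> MpM R majdim m)
    (y : 'I_k -> M R m m) (S : MpM R majdim m) :
  (forall j, reform_cvg U (fun t => x t j) (y j)) -> reform_cvg U T S ->
  reform_cvg U W (idop R (idx m)) ->
  (\forall t \near U, [/\ cone bc lam (x t) (W t) (E t), op_le (E t) (T t)
    & forall xi, reform (W t) xi xi <= nrm2 xi]) ->
  majfun y S.
Proof.
move=> xy TS WI co; have PU : ProperFilter U by exact: ultra_proper.
have [|Z EZ] := @pos_ultra_lim R A U FU _ E maj_bound maj_bound_gt0.
  apply: filterS co => t [Ec _ W1]; split; first by case: Ec.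
  by apply: (cone_bound Ec) => //; exact: penalty_bound_ge0.
exists Z; first by apply: (cone_lim xy WI EZ); apply: filterS co => t [].
apply: (@op_pos_lim _ _ U _ _ (fun t => T t - E t)).
  move=> u v; rewrite reformD reformN; under eq_fun do rewrite reformD reformN.
  by apply: cvgB; [exact: TS|exact: EZ].
by apply: filterS co => t [].
Qed.

Lemma majfun_lsc : lsc_nc r majfun.
Proof.
move=> m z; rewrite closureEcvg => -[G PG [Gz gG]].
have [U [UU GU]] := ultraFilterLemma PG.
have PU : ProperFilter U by exact: ultra_proper.
have Ugr : U (nc_graph r majfun (n := m)) by apply: GU; exact: gG.
have Uz : U --> z by apply: cvg_trans Gz => X; exact: GU.
have xz j : reform_cvg U (fun w : {ptws 'I_k -> M R m m} * MpM R majdim m => w.1 j) (z.1 j).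
  apply: cvg_reform; apply: (cvg_comp (fun w => w.1) (fun f : {ptws _ -> _} => f j)).
    exact: (cvg_comp _ _ Uz (@cvg_fst _ _ _ _ _)).
  exact: (@proj_continuous _ (fun=> M R m m)).
have Tz : reform_cvg U (fun w : {ptws 'I_k -> M R m m} * MpM R majdim m => w.2) z.2.
  by apply: cvg_reform; exact: (cvg_comp _ _ Uz (@cvg_snd _ _ _ _ _)).
pose E (w : {ptws 'I_k -> M R m m} * MpM R majdim m) :=
  xget 0 [set E | cone bc lam w.1 (idop R (idx m)) E /\ op_le E w.2].
split; first by apply: (ball_lim xz); apply: filterS Ugr => w [].
apply: (@majfun_lim _ U UU m _ (fun=> idop R (idx m)) E _ _ _ xz Tz).
  by move=> u v; exact: cvg_cst.
apply: filterS Ugr => w [_ [E0 Ec ET]].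
have [? ?] : [set E | cone bc lam w.1 (idop R (idx m)) E /\ op_le E w.2] (E w).
  by rewrite /E; apply: xgetPex; exists E0.
by split => // xi; rewrite reform_id -nrm2_Re.
Qed.

(** The partial sums of admissible block operators stay in the cone, with [W]
    increasing to the identity, so that the limit exists along an ultrafilter. *)
Lemma majfun_convex : convex_nc r majfun.
Proof.
move=> m N x T a gr _ aI y S xy TS.
have [U [UU GU]] := ultraFilterLemma (eventually_filter).
have PU : ProperFilter U by exact: ultra_proper.
have toU (L : topologicalType) (u : nat -> L) (l : L) : u @ \oo --> l -> u @ U --> l.
  by move=> ul; apply: cvg_trans ul => X; exact: GU.
pose E i := xget 0 [set E | cone bc lam (x i) (idop R (idx (N i))) E /\ op_le E (T i)].
have EP i : cone bc lam (x i) (idop R (idx (N i))) (E i) /\ op_le (E i) (T i).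
  have [_ [E0 Ec ET]] := gr i.
  suff : [set E | cone bc lam (x i) (idop R (idx (N i))) E /\ op_le E (T i)] (E i) by [].
  by rewrite /E; apply: xgetPex; exists E0.
pose xs t j := series (fun i => compress (a i) (x i j)) t.
pose Ws t := series (fun i => compress (a i) (idop R (idx (N i)))) t.
pose Es t := series (fun i => compress (ampl 'I_n.+1 (a i)) (E i)) t.
pose Ts t := series (fun i => compress (id_tensor majdim (a i)) (T i)) t.
have xsU j : reform_cvg U (fun t => xs t j) (y j) by exact: (cvg_reform (toU _ _ _ (xy j))).
have TsU : reform_cvg U Ts S by exact: (cvg_reform (toU _ _ _ TS)).
have WsI : reform_cvg \oo Ws (idop R (idx m)).
  apply: cvg_reform; have -> // : Ws = series (fun i => opcomp (adj (a i)) (a i)).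
  by apply/funext => t; apply: eq_bigr => i _; apply: op_ext.
have WsU : reform_cvg U Ws (idop R (idx m)) by move=> u v; exact: (toU _ _ _ (WsI u v)).
have Wle t xi : reform (Ws t) xi xi <= nrm2 xi.
  rewrite nrm2_Re -reform_id.
  apply: (@cvg_le_lim R _ \oo _ (fun=> reform (Ws t) xi xi) (fun s => reform (Ws s) xi xi)).
  - exact: cvg_cst.
  - exact: WsI.
  exists t => // s /= ts; rewrite !reform_series [leRHS](big_cat_nat (leq0n t) ts)/= lerDl.
  by apply: sumr_ge0 => i _; rewrite reform_compress reform_id -nrm2_Re nrm2_ge0.
have co t : cone bc lam (xs t) (Ws t) (Es t) /\ op_le (Es t) (Ts t).
  elim: t => [|t [IHc IHl]].
    have E0 (V : zmodType) (u : nat -> V) : series u 0%N = 0 by rewrite /series /= big_geq.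
    have -> : xs 0%N = (fun=> 0) by apply/funext => j; rewrite /xs E0.
    rewrite /Ws /Es /Ts !E0; split; first exact: cone0.
    by rewrite /op_le subrr; exact: op_pos0.
  have ES (V : zmodType) (u : nat -> V) : series u t.+1 = series u t + u t.
    by rewrite /series /= big_nat_recr.
  have [Ec El] := EP t.
  have -> : xs t.+1 = (fun j => xs t j + compress (a t) (x t j)).
    by apply/funext => j; rewrite /xs ES.
  rewrite /Ws /Es /Ts !ES; split; first by apply: coneD IHc _; exact: cone_compress.
  rewrite /op_le opprD addrACA; apply: op_posD => //.
  exact: op_le_compress.
split; last first.
  apply: (@majfun_lim nat U UU m xs Ws Es Ts y S xsU TsU WsU); apply: nearW => t.
  by have [] := co t; split.
apply: (ball_lim xsU); apply: nearW => t; apply/ballP => xi eta.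
have rs j : reform (xs t j) (eta j) xi =
    \sum_(0 <= i < t) reform (x i j) (a i (eta j)) (a i xi).
  by rewrite reform_series; apply: eq_bigr => i _; rewrite reform_compress.
have Wn v : \sum_(0 <= i < t) nrm2 (a i v) <= nrm2 v.
  apply: le_trans (Wle t v); rewrite reform_series; apply: ler_sum => i _.
  by rewrite reform_compress reform_id nrm2_Re.
rewrite (eq_bigr _ (fun j _ => rs j)) exchange_big mulr_sumr /=.
apply: (@le_trans _ _ (\sum_(0 <= i < t) (r ^+ 2 * nrm2 (a i xi) + \sum_j nrm2 (a i (eta j))))).
  by apply: ler_sum => i _; have [/ballP + _] := gr i; apply.
rewrite big_split /= -mulr_sumr exchange_big /=; apply: lerD.
  by rewrite ler_wpM2l// sqr_ge0.
by apply: ler_sum => j _; exact: Wn.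
Qed.

Lemma majfun_majorization : nc_majorization_function r majfun.
Proof.
split; [exact: majfun_multivalued|exact: majfun_bounded|exact: majfun_lsc|].
exact: majfun_convex.
Qed.

End majfun.

(** * Rank one operators and factorization of positive operators *)

Section rank_one.
Variables (R : realType).

Lemma inner_fin n (x y : l2 R 'I_n) :
  inner x y = \sum_j (x j : R[i]) * (y j : R[i])^*.
Proof.
rewrite {1}[x]l2_fin_decomp inner_suml; apply: eq_bigr => j _.
by rewrite innerZl inner_basisl.
Qed.

Lemma nrm2Zc (I : choiceType) (c : R[i]) (x : l2 R I) :
  nrm2 (c *: x) = normc c ^+ 2 * nrm2 x.
Proof.
rewrite nrm2_Re innerZl innerZr innerxx sqr_normcE.
by case: c => a b; rewrite conj_complexE /=; ring.
Qed.

Section ket.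
Variables (I : choiceType) (u : l2 R I).

Lemma ket_subproof :
  (fun x : l2 R 'I_1 => (x ord0 : R[i]) *: u) \in @bounded_linear R 'I_1 I.
Proof.
apply/bounded_linearP; split.
  by move=> c x y; rewrite l2PE scalerDl scalerA.
exists (nrm2 u); first exact: nrm2_ge0.
move=> x; rewrite -!nrm2E -EFinM lee_fin nrm2Zc mulrC ler_wpM2l ?nrm2_ge0//.
rewrite [nrm2 x]nrm2_Re inner_fin big_ord1 sqr_normcE.
by case: (x ord0) => a b; rewrite conj_complexE /= mulrN opprK !expr2.
Qed.

(** The map [C -> l2 I] with range spanned by [u]. *)
Definition ket : op R 'I_1 I := Op ket_subproof.

Lemma adj_ket x : (adj ket x) ord0 = inner x u.
Proof.
have E : ket (Defs.basis R ord0) = u by exact: scale1r.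
by rewrite -inner_basis -adjPr E.
Qed.

End ket.

(** The rank one operator [x |-> <x, v> u]. *)
Definition rank1 (I J : choiceType) (u : l2 R J) (v : l2 R I) : op R I J :=
  opcomp (ket u) (adj (ket v)).

Lemma rank1E (I J : choiceType) (u : l2 R J) (v : l2 R I) x :
  rank1 u v x = inner x v *: u.
Proof. by rewrite opcompE -adj_ket. Qed.

Lemma inner_rank1 (I J : choiceType) (u : l2 R J) (v : l2 R I) x y :
  inner (rank1 u v x) y = inner x v * inner u y.
Proof. by rewrite rank1E innerZl. Qed.

Lemma op_pos_rank1 (I : choiceType) (u : l2 R I) : op_pos (rank1 u u).
Proof. exact: op_pos_mul_adj. Qed.


Lemma conjZr (t : R) (q : R[i]) : (t%:C%C * q)^* = t%:C%C * q^*.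
Proof.
by case: q => a b; rewrite !conj_complexE /=; apply/eqP; rewrite eq_complex /=;
  apply/andP; split; apply/eqP; ring.
Qed.

(** A positive operator that vanishes on all but finitely many basis vectors is
    a finite sum of rank one operators; each step splits off one basis vector by
    taking a Schur complement. *)
Lemma pos_factor (I : choiceType) (s : seq I) (E : op R I I) : op_pos E ->
  (forall i, i \notin s -> E (Defs.basis R i) = 0) ->
  exists W : seq (l2 R I),
    forall u v, inner (E u) v = \sum_(w <- W) inner u w * inner w v.
Proof.
elim: s E => [|i s IH] E Ep Es.
  exists [::] => u v; rewrite big_nil.
  have /selfadjointP Esa := op_pos_sa Ep.
  rewrite [E u](_ : _ = 0) ?inner0l//; apply: l2_ext => i.
  by rewrite -inner_basis Esa Es// inner0r.
have /selfadjointP Esa := op_pos_sa Ep.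
set e := Defs.basis R i; set c := complex.Re (inner (E e) e).
have cE : inner (E e) e = c%:C%C.
  by have := Ep e; rewrite /c lecE => /andP[/eqP + _]; case: (inner _ _) => a b /= ->.
have c0 : 0 <= c by have := Ep e; rewrite cE lecR.
have Esub u t : inner (E (u - t *: e)) (u - t *: e) =
    inner (E u) u - t^* * inner (E u) e - t * (inner (E u) e)^* + t * t^* * c%:C%C.
  rewrite linearB linearZ innerBl !innerBr !innerZl !innerZr cE.
  by rewrite [inner (E e) u]Esa [inner e (E u)]innerC; ring.
move: c0; rewrite le_eqVlt => /predU1P[c0|c0].
  apply: IH => // j js; have [->|ji] := eqVneq j i; last by apply: Es; rewrite inE negb_or ji.
  apply: inner_extl => z; rewrite inner0r -Esa -/e.
  pose q := inner (E z) e.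
  have H (t : R) : 2 * t * (normc q ^+ 2) <= complex.Re (inner (E z) z).
    have := Ep (z - (t%:C%C * q) *: e); rewrite Esub -c0 mulr0 addr0 => /ge0_Re.
    rewrite !cReD !cReN -/q sqr_normcE conjZr.
    by case: (q) => a b; rewrite conj_complexE /=; lra.
  have q0 : normc q ^+ 2 = 0.
    apply/eqP; rewrite eq_le sqr_ge0 andbT leNgt; apply/negP => qp.
    have := H ((complex.Re (inner (E z) z) + 1) / (2 * normc q ^+ 2)).
    rewrite (_ : 2 * _ * _ = complex.Re (inner (E z) z) + 1); first by lra.
    by field; move: qp; rewrite exprn_even_gt0 //= => ->.
  by apply: eq0_normc; apply/eqP; rewrite -sqrf_eq0 q0.
(* The vector to split off is [w = E e / sqrt c]; positivity of [E - w w^*] at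
   [u] is positivity of [E] at [u - (<E u, e> / c) e]. *)
pose t := Num.sqrt c.
have t0 : 0 < t by rewrite sqrtr_gt0.
have tt : t * t = c by rewrite -expr2 sqr_sqrtr// ltW.
pose w := (t^-1)%:C%C *: E e.
have we : inner e w = t%:C%C.
  rewrite innerZr conj_real -Esa cE -tt -rmorphM /= mulrA mulVf ?mul1r//.
  by rewrite gt_eqF.
have uw u : inner u w = (t^-1)%:C%C * inner (E u) e.
  by rewrite innerZr conj_real -Esa.
have E'p : op_pos (E - rank1 w w).
  move=> u; rewrite opDE opNE innerBl inner_rank1 [inner w u]innerC uw.
  have := Ep (u - ((c^-1)%:C%C * inner (E u) e) *: e); rewrite Esub.
  congr (0 <= _); rewrite !conjZr -!addrA; congr (_ + _).
  have -> : (c^-1)%:C%C = (t^-1)%:C%C * (t^-1)%:C%C :> R[i].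
    by rewrite -rmorphM /= -invfM tt.
  have -> : c%:C%C = t%:C%C * t%:C%C :> R[i] by rewrite -rmorphM tt.
  have tV : (t^-1)%:C%C * t%:C%C = 1 :> R[i] by rewrite -rmorphM /= mulVf ?gt_eqF.
  set tc := t%:C%C in tV *; set tv := (t^-1)%:C%C in tV *.
  set q := inner (E u) e.
  transitivity (- (tv * tv * q * q^*) * (2 - (tv * tc) * (tv * tc))); first by ring.
  by rewrite tV; ring.
have [j js|W HW] := IH _ E'p.
  rewrite opDE opNE rank1E; have [->|ji] := eqVneq j i.
    rewrite -/e we /w scalerA -rmorphM /= mulfV ?gt_eqF// scale1r subrr.
    by [].
  rewrite uw Es ?inE ?negb_or ?ji// inner0l mulr0 scale0r subrr.
  by [].
exists (w :: W) => u v; rewrite big_cons -HW opDE opNE innerBl inner_rank1.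
by rewrite addrC subrK.
Qed.

End rank_one.

(** * The map with a given Choi operator *)

Section choi_map.
Variables (R : realType) (n : nat).
Notation e := (@Defs.basis R 'I_n).
Variable E : op R ('I_n.+1 * 'I_n)%type ('I_n.+1 * 'I_n)%type.

(** The Choi block [(j, l)] of [E]. *)
Definition corner (j l : 'I_n) : op R 'I_n 'I_n :=
  opcomp (adj (ten (slot j))) (opcomp E (ten (slot l))).

Lemma inner_corner j l xi eta :
  inner (corner j l xi) eta = inner (E (ten (slot l) xi)) (ten (slot j) eta).
Proof. by rewrite /corner opcompE -adjPr. Qed.

(** The linear map on matrices that sends the matrix unit [(j, l)] to the block
    [corner j l]. *)
Definition choi_map (T : op R 'I_n 'I_n) : op R 'I_n 'I_n :=
  \sum_j \sum_l inner (T (e l)) (e j) *: corner j l.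

Lemma inner_choi_map T xi eta : inner (choi_map T xi) eta =
  \sum_j \sum_l inner (T (e l)) (e j) * inner (E (ten (slot l) xi)) (ten (slot j) eta).
Proof.
rewrite /choi_map op_sumE inner_suml; apply: eq_bigr => j _.
rewrite op_sumE inner_suml; apply: eq_bigr => l _.
by rewrite opZE innerZl inner_corner.
Qed.

Lemma choi_map_linear : linear choi_map.
Proof.
move=> c S T; apply: op_ext_inner => xi eta.
rewrite opDE opZE innerDl innerZl !inner_choi_map mulr_sumr -big_split /=.
apply: eq_bigr => j _; rewrite mulr_sumr -big_split /=; apply: eq_bigr => l _.
by rewrite ?opDE ?opZE innerDl innerZl mulrDl mulrA.
Qed.

HB.instance Definition _ := GRing.isLinear.Build R[i] (op R 'I_n 'I_n)
  (op R 'I_n 'I_n) _ choi_map choi_map_linear.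

(** Complete positivity: a factorization of [E] into rank one operators turns
    the form of [choi_map T] into a sum of values of the form of [T]. *)
Lemma choi_map_cp : op_pos E -> completely_positive choi_map.
Proof.
move=> Ep d T Tp x.
have [W HW] := @pos_factor R _ (enum {: 'I_n.+1 * 'I_n}) E Ep
  (fun i => ltac:(by rewrite mem_enum)).
pose z w q : l2 R 'I_n := \sum_l inner (ten (slot l) (x q)) w *: e l.
rewrite (_ : \sum_p _ = \sum_(w <- W) \sum_p \sum_q inner (T p q (z w q)) (z w p)).
  by apply: sumr_ge0 => w _; exact: Tp.
rewrite [RHS]exchange_big /=; apply: eq_bigr => p _.
rewrite [RHS]exchange_big /=; apply: eq_bigr => q _.
rewrite mxE inner_choi_map.
have zE w : inner (T p q (z w q)) (z w p) = \sum_j \sum_l inner (T p q (e l)) (e j) *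
    (inner (ten (slot l) (x q)) w * inner w (ten (slot j) (x p))).
  rewrite inner_sumr; apply: eq_bigr => j _.
  rewrite linear_sum inner_suml; apply: eq_bigr => l _.
  by rewrite linearZ innerZr innerZl [inner w _]innerC; ring.
under [RHS]eq_bigr do rewrite zE.
rewrite [RHS]exchange_big /=; apply: eq_bigr => j _.
rewrite [RHS]exchange_big /=; apply: eq_bigr => l _.
by rewrite HW mulr_sumr.
Qed.

Lemma choi_map_unital :
  (forall xi eta, \sum_j reform E (ten (slot j) xi) (ten (slot j) eta) =
    reform (idop R 'I_n) xi eta) -> unital choi_map.
Proof.
move=> HE; apply: reform_ext => xi eta; rewrite -HE /reform inner_choi_map cRe_sum.
apply: eq_bigr => j _; rewrite (bigD1 j)//= inner_bb eqxx mul1r big1 ?addr0//.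
by move=> l /negPf lj; rewrite inner_bb lj mul0r.
Qed.

Lemma choi_map_sa T : op_pos E -> selfadjoint T -> selfadjoint (choi_map T).
Proof.
move=> /op_pos_sa/selfadjointP Esa /selfadjointP Tsa; apply/selfadjointP => xi eta.
rewrite [RHS]innerC !inner_choi_map rmorph_sum exchange_big /=.
apply: eq_bigr => j _; rewrite rmorph_sum /=; apply: eq_bigr => l _.
by rewrite rmorphM /= -!innerC Tsa Esa.
Qed.

End choi_map.

Section zero_diag.
Variables (R : realType) (m : nat).

Lemma reform_ZZ (I : choiceType) (T : op R I I) (c : R[i]) x :
  reform T (c *: x) (c *: x) = normc c ^+ 2 * reform T x x.
Proof.
rewrite /reform linearZ innerZl innerZr mulrA sqr_normcE.
by case: c (inner _ _) => a b [u v]; rewrite conj_complexE /=; ring.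
Qed.

(** The null vectors of a positive form are a subspace. *)
Lemma pos_form_eq0 (I : choiceType) (E : op R I I) (u : 'I_m -> l2 R I) (c : 'I_m -> R[i]) :
  op_pos E -> (forall i, reform E (u i) (u i) = 0) ->
  reform E (\sum_i c i *: u i) (\sum_i c i *: u i) = 0.
Proof.
move=> Ep u0; apply/eqP; rewrite eq_le; apply/andP; split; last first.
  by have /op_pos_reform[_] := Ep; apply.
apply: (le_trans (pos_reform_sum _ Ep)).
by rewrite big1 ?mulr0// => i _; rewrite reform_ZZ u0 mulr0.
Qed.

Lemma pos_zero_diag (D : op R 'I_m 'I_m) : op_pos D ->
  (forall i, reform D (Defs.basis R i) (Defs.basis R i) = 0) -> D = 0.
Proof.
move=> Dp D0; apply: polar_eq0 => x.
have : reform D x x = 0 by rewrite {1 2}[x]l2_fin_decomp; exact: pos_form_eq0.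
have := Dp x; rewrite lecE /reform => /andP[/eqP + _].
by case: (inner _ _) => a b /= -> ->.
Qed.

End zero_diag.

(** * Majorization implies a channel *)

Section ball_exists.
Variables (R : realType).

(** Every tuple lies in all sufficiently large balls. *)
Lemma ball_exists (I : choiceType) k (x : 'I_k -> op R I I) :
  exists2 c : R, 0 <= c & forall r : R, c <= r ^+ 2 ->
    op_le (\sum_j opcomp (x j) (adj (x j))) ((r ^+ 2)%:C%C *: idop R I).
Proof.
have cex j : exists c : R, 0 <= c /\ forall xi, nrm2 (adj (x j) xi) <= c * nrm2 xi.
  by have [c c0 H] := op_nrm2 (adj (x j)); exists c.
have [c Hc] := boolp.choice cex.
exists (\sum_j c j); first by apply: sumr_ge0 => j _; have [] := Hc j.
move=> r cr; apply/op_le_reform.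
- by apply/op_pos_sa/op_pos_sum => j _; exact: op_pos_mul_adj.
- by apply/op_pos_sa/op_posZ; [exact: sqr_ge0|exact: op_pos_id].
move=> xi; rewrite reformZ reform_id -nrm2_Re reform_sum.
apply: (@le_trans _ _ ((\sum_j c j) * nrm2 xi)); last by rewrite ler_wpM2r ?nrm2_ge0.
rewrite mulr_suml; apply: ler_sum => j _.
by rewrite reform_mul_adj -nrm2_Re; have [_] := Hc j; apply.
Qed.

End ball_exists.

Section omega.
Variables (R : realType) (n k : nat) (b : 'I_k -> op R 'I_n 'I_n).
Notation e := (@Defs.basis R 'I_n).

(** The vector [sum_j e_(slot j) (x) e_j]; the rank one operator on it has the
    matrix units as Choi blocks and a zero penalty block. *)
Definition omega : l2 R ('I_n.+1 * 'I_n)%type := \sum_j ten (slot j) (e j).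

Lemma inner_omega_slot j (xi : l2 R 'I_n) : inner (ten (slot j) xi) omega = xi j.
Proof.
rewrite inner_sumr (bigD1 j)//= inner_ten eqxx mul1r inner_basis big1 ?addr0//.
move=> l /negPf lj; rewrite inner_ten (inj_eq (@lift_inj _ _)) eq_sym lj.
by rewrite mul0r.
Qed.

Lemma inner_omega0 (xi : l2 R 'I_n) : inner (ten ord0 xi) omega = 0.
Proof. by rewrite inner_sumr big1// => j _; rewrite inner_ten mul0r. Qed.

Lemma inner_omega_op u v :
  inner (rank1 omega omega u) v = inner u omega * (inner v omega)^*.
Proof. by rewrite inner_rank1 [inner omega v]innerC. Qed.

(** The matrix entries of the tuple [b]. *)
Definition coefs i (j l : 'I_n) : R[i] := inner (b i (e l)) (e j).

(** The identity map witnesses that [b] is reached without penalty. *)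
Lemma cone_omega (lam : R) : 0 <= lam ->
  cone coefs lam b (idop R 'I_n) (rank1 omega omega).
Proof.
move=> lam0; split => [|xi eta|xi|i xi].
- exact: op_pos_rank1.
- rewrite reform_id inner_fin cRe_sum; apply: eq_bigr => j _.
  by rewrite /reform inner_omega_op !inner_omega_slot.
- rewrite /reform inner_omega_op inner_omega0 mul0r.
  by rewrite mulr_ge0// -/(reform _ _ _) reform_id -nrm2_Re nrm2_ge0.
- rewrite [X in _ <= X]/reform inner_omega_op inner_omega0 mul0r.
  rewrite (_ : reform _ _ _ = choi coefs (rank1 omega omega) i xi) ?subrr ?normr0//.
  rewrite /reform {1 2}[xi]l2_fin_decomp linear_sum inner_sumr cRe_sum.
  apply: eq_bigr => j _; rewrite inner_suml cRe_sum; apply: eq_bigr => l _.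
  rewrite linearZ innerZr innerZl /reform inner_omega_op !inner_omega_slot.
  rewrite [((_ *: xi) j)](_ : _ = (coefs i j l)^* * xi j)//.
  by rewrite rmorphM /= conjCK /coefs; congr complex.Re; ring.
Qed.

End omega.

Section ptrace_theory.
Variables (R : realType) (n : nat) (n_gt0 : (0 < n)%N) (p : Defs.dim).
Implicit Types S T : MpM R p (Fin n_gt0).

Lemma inner_ptrace T x y : inner (ptrace T x) y =
  n%:R^-1 * \sum_(j < n) inner (T (ins R (idx p) (j : idx (Fin n_gt0)) x))
                               (ins R (idx p) (j : idx (Fin n_gt0)) y).
Proof.
rewrite /ptrace opZE innerZl op_sumE inner_suml; congr (_ * _).
by apply: eq_bigr => j _; rewrite compressE.
Qed.

Lemma op_le_ptrace S T : op_le S T -> op_le (ptrace S) (ptrace T).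
Proof.
move=> ST x; rewrite opDE opNE innerBl !inner_ptrace -mulrBr -sumrB.
rewrite mulr_ge0 ?invr_ge0 ?ler0n// sumr_ge0// => j _.
by rewrite -innerBl -opNE -opDE; exact: ST.
Qed.

End ptrace_theory.

Section majorized_channel.
Variables (R : realType) (k n : nat) (n_gt0 : (0 < n)%N).
Notation e := (@Defs.basis R 'I_n).

Lemma inner_ptrace_basis (T : MpM R (majdim n) (Fin n_gt0)) (i j : 'I_n.+1) :
  inner (ptrace T (Defs.basis R i)) (Defs.basis R j) =
  n%:R^-1 * \sum_s inner (T (ten i (e s))) (ten j (e s)).
Proof.
rewrite inner_ptrace; congr (_ * _); apply: eq_bigr => s _.
by rewrite !ins_basis !ten_basis.
Qed.

Lemma majorized_channel (a b : 'I_k -> M R (Fin n_gt0) (Fin n_gt0)) :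
  (forall i, selfadjoint (a i)) -> (forall i, selfadjoint (b i)) ->
  nc_majorized a b ->
  exists Phi : {linear M R (Fin n_gt0) (Fin n_gt0) -> M R (Fin n_gt0) (Fin n_gt0)},
    [/\ trace_preserving Phi, unital Phi, completely_positive Phi
      & forall i, Phi (b i) = a i].
Proof.
move=> asa bsa maj.
have [ca ca0 aball] := ball_exists a; have [cb cb0 bball] := ball_exists b.
pose r : R := 1 + ca + cb.
have r0 : 0 < r by rewrite /r -addrA ltr_pwDl// addr_ge0.
have r1 : r <= r ^+ 2 by rewrite expr2 ler_peMr ?(ltW r0)// /r; lra.
have abr : nc_ball r a by apply: aball; move: r1; rewrite /r; lra.
have bbr : nc_ball r b by apply: bball; move: r1; rewrite /r; lra.
pose F := majfun (coefs b) r.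
have Fmaj : nc_majorization_function r F by exact: majfun_majorization.
pose E0 : MpM R (majdim n) (Fin n_gt0) := rank1 (omega R n) (omega R n).
have FE0 : F _ b E0.
  exists E0; last by move=> z; rewrite subrr op0E inner0l.
  by apply: cone_omega; exact: penalty_bound_ge0.
have [_ [T FT <-] leT] := maj _ r F r0 abr bbr Fmaj (ptrace E0) (ex_intro2 _ _ E0 FE0 erefl).
have [E [Ep Esum E00 Ea] ET] := FT.
(* The diagonal entries of [D >= 0] have sum at most zero: the Choi parts of
   both partial traces have trace one, and the penalty part of [E0] vanishes. *)
pose D := ptrace E0 - ptrace E.
have Dp : op_pos D.
  rewrite /D -(subrK (ptrace T) (ptrace E0)) -addrA.
  by apply: op_posD => //; exact: op_le_ptrace.
have nR0 : (n%:R : R) != 0 by rewrite pnatr_eq0 -lt0n.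
have q0 v : 0 <= reform E v v by have /op_pos_reform[_] := Ep; apply.
have rp (S : MpM R (majdim n) (Fin n_gt0)) i :
    reform (ptrace S) (Defs.basis R i) (Defs.basis R i) =
    n%:R^-1 * \sum_s reform S (ten i (e s)) (ten i (e s)).
  rewrite /reform inner_ptrace_basis -cRe_sum.
  by rewrite -cReZ; congr (complex.Re (_ * _)); rewrite rmorphV ?unitfE// rmorph_nat.
have rE00 s : reform E0 (ten ord0 (e s)) (ten ord0 (e s)) = 0.
  by rewrite /reform inner_omega_op inner_omega0 mul0r.
have rE0 j s : reform E0 (ten (slot j) (e s)) (ten (slot j) (e s)) = (j == s)%:R.
  rewrite /reform inner_omega_op !inner_omega_slot /=.
  by case: eqP => _; rewrite ?mul0r// conjC1 mul1r.
have D0 : D = 0.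
  apply: pos_zero_diag => // i.
  have Dge j : 0 <= reform D (Defs.basis R j) (Defs.basis R j).
    by have /op_pos_reform[_] := Dp; apply.
  have [j ->|->] := unliftP ord0 i; last first.
    apply/eqP; rewrite eq_le Dge andbT /D reformD reformN !rp.
    rewrite big1 ?mulr0 ?sub0r ?oppr_le0 => [|s _]; last exact: rE00.
    by rewrite mulr_ge0 ?invr_ge0// sumr_ge0.
  have /eqP : \sum_j reform D (Defs.basis R (slot j)) (Defs.basis R (slot j)) = 0.
    under eq_bigr do rewrite /D reformD reformN !rp.
    rewrite sumrB -!mulr_sumr -mulrBr; apply/eqP; rewrite mulf_eq0; apply/orP; right.
    rewrite subr_eq0 [X in _ == X]exchange_big /= [X in X == _]exchange_big /=.
    apply/eqP; apply: eq_bigr => s _; rewrite [RHS](Esum (e s) (e s)).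
    rewrite reform_id -nrm2_Re nrm2_basis (eq_bigr _ (fun j _ => rE0 j s)).
    rewrite (bigD1 s)//= eqxx big1 ?addr0// => l /negPf ls.
    by rewrite ls.
  rewrite psumr_eq0// => /allP/(_ j); rewrite mem_index_enum => /(_ isT)/eqP.
  by [].
have Etr j l : \sum_s inner (E (ten (slot l) (e s))) (ten (slot j) (e s)) = (l == j)%:R.
  have /eqP := D0; rewrite subr_eq0 => /eqP DE.
  have nC0 : (n%:R^-1 : R[i]) != 0 by rewrite invr_eq0 pnatr_eq0 -lt0n.
  apply: (mulfI nC0); rewrite -inner_ptrace_basis -DE inner_ptrace_basis.
  congr (_ * _); under eq_bigr do rewrite inner_omega_op !inner_omega_slot.
  rewrite (bigD1 l)//= eqxx mul1r big1 ?addr0.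
    by rewrite eq_sym; case: eqP => _; rewrite ?conjC1 ?conjC0.
  by move=> s /negPf; rewrite eq_sym => ->; rewrite mul0r.
have pen0 xi : reform E (ten ord0 xi) (ten ord0 xi) = 0.
  have es0 s : reform E (ten ord0 (e s)) (ten ord0 (e s)) = 0.
    have := congr1 (fun S => reform S (Defs.basis R ord0) (Defs.basis R ord0)) D0.
    rewrite /D reformD reformN !rp reform0 big1 => [|j _]; last exact: rE00.
    move/eqP; rewrite mulr0 sub0r oppr_eq0 mulf_eq0 invr_eq0 (negPf nR0) /=.
    rewrite psumr_eq0// => /allP/(_ s); rewrite mem_index_enum => /(_ isT)/eqP.
    by [].
  rewrite [xi]l2_fin_decomp linear_sum.
  under eq_bigr do rewrite linearZ.
  exact: pos_form_eq0.
exists (choi_map E : {linear M R (Fin n_gt0) (Fin n_gt0) -> M R (Fin n_gt0) (Fin n_gt0)}).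
split.
- move=> S; rewrite /tr; congr (_ * _).
  under eq_bigr do rewrite inner_choi_map.
  rewrite exchange_big /=; apply: eq_bigr => j _.
  rewrite exchange_big /= (bigD1 j)//= -mulr_sumr Etr eqxx mulr1 big1 ?addr0//.
  by move=> l /negPf lj; rewrite -mulr_sumr Etr lj mulr0.
- exact: choi_map_unital.
- exact: choi_map_cp.
move=> i; apply/eqP; rewrite -subr_eq0; apply/eqP; apply: polar_eq0 => xi.
have sa : selfadjoint (choi_map E (b i) - a i).
  have /selfadjoint_reform H1 := choi_map_sa Ep (bsa i).
  have /selfadjoint_reform H2 := asa i.
  by apply/selfadjoint_reform => x y; rewrite !reformD !reformN H1 H2.
have re0 : reform (choi_map E (b i) - a i) xi xi = 0.
  have := Ea i xi; rewrite pen0 normr_le0 subr_eq0 reformD reformN => /eqP ->.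
  apply/eqP; rewrite subr_eq0 /reform inner_choi_map cRe_sum; apply/eqP.
  apply: eq_bigr => j _; rewrite cRe_sum; apply: eq_bigr => l _.
  by rewrite /reform linearZ innerZr conjCK.
move/selfadjointP : sa => /(_ xi xi); rewrite [RHS]innerC; move: re0; rewrite /reform.
case: (inner _ _) => u v; rewrite conj_complexE /= => -> [] vv.
by apply/eqP; rewrite eq_complex /= eqxx; apply/eqP; lra.
Qed.

End majorized_channel.

(** * Kraus decomposition, a channel implies majorization *)

Section kraus.
Variables (R : realType) (n : nat).
Notation e := (@Defs.basis R 'I_n).
Notation H := (op R 'I_n 'I_n).

(** Expansion of a matrix in the matrix units. *)
Lemma op_unit_decomp (T : H) :
  T = \sum_j \sum_l inner (T (e l)) (e j) *: rank1 (e j) (e l).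
Proof.
apply: op_ext_inner => x y; rewrite op_sumE inner_suml.
rewrite {1}[x]l2_fin_decomp linear_sum {1}[y]l2_fin_decomp inner_sumr.
apply: eq_bigr => j _; rewrite op_sumE !inner_suml; apply: eq_bigr => l _.
rewrite opZE [RHS]innerZl inner_rank1 (inner_basis x) (inner_basisl y).
by rewrite linearZ innerZr innerZl; ring.
Qed.

(** The operator on [l2 ('I_n * 'I_n)] with blocks [S j l]. *)
Lemma block_op (S : 'I_n -> 'I_n -> H) :
  exists2 C : op R ('I_n * 'I_n)%type ('I_n * 'I_n)%type,
    forall u v, inner (C u) v =
      \sum_j \sum_l inner (S j l (adj (ten l) u)) (adj (ten j) v)
  & forall j l xi eta, inner (C (ten l xi)) (ten j eta) = inner (S j l xi) eta.
Proof.
exists (\sum_j \sum_l opcomp (ten j) (opcomp (S j l) (adj (ten l)))).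
  move=> u v; rewrite op_sumE inner_suml; apply: eq_bigr => j _.
  rewrite op_sumE inner_suml; apply: eq_bigr => l _.
  by rewrite !opcompE adjP.
move=> j l xi eta.
have B j' l' : inner (opcomp (ten j') (opcomp (S j' l') (adj (ten l'))) (ten l xi)) (ten j eta)
    = (j' == j)%:R * inner (S j' l' ((l' == l)%:R *: xi)) eta.
  by rewrite !opcompE inner_ten adj_ten.
have -> : inner (S j l xi) eta =
    \sum_j' \sum_l' (j' == j)%:R * inner (S j' l' ((l' == l)%:R *: xi)) eta.
  rewrite (bigD1 j)//= (bigD1 l)//= !eqxx mul1r scale1r.
  rewrite big1 => [|l' /negPf ->]; last by rewrite scale0r linear0 inner0l mulr0.
  by rewrite addr0 big1 ?addr0// => j' /negPf ->; rewrite big1// => l' _; rewrite mul0r.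
rewrite op_sumE inner_suml; apply: eq_bigr => j' _.
by rewrite op_sumE inner_suml; apply: eq_bigr => l' _.
Qed.

(** The Kraus operators are the vectors of a factorization of the Choi operator,
    read as matrices. *)
Lemma kraus (Phi : {linear H -> H}) : completely_positive Phi ->
  exists ks : seq H, forall T, Phi T = \sum_(a <- ks) compress a T.
Proof.
move=> cp.
pose U : 'M[H]_n := \matrix_(j, l) rank1 (e j) (e l).
have Up : mx_pos U.
  move=> x; rewrite (_ : \sum_i _ = (\sum_j x j j) * (\sum_j x j j)^*).
    by rewrite mul_conjC_ge0.
  rewrite rmorph_sum /= mulr_sumr; apply: eq_bigr => i _.
  rewrite mulr_suml; apply: eq_bigr => j _.
  by rewrite mxE inner_rank1 inner_basis inner_basisl.
have [C CE CU] := block_op (fun j l => Phi (rank1 (e j) (e l))).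
have Cp : op_pos C.
  move=> v; rewrite CE; have := cp n U Up (fun j => adj (ten j) v).
  by under eq_bigr do under eq_bigr do rewrite !mxE.
have [W HW] := @pos_factor R _ (enum {: 'I_n * 'I_n}) C Cp
  (fun i => ltac:(by rewrite mem_enum)).
pose al w : H := \sum_l rank1 (e l) (adj (ten l) w).
have alE w xi l : inner (al w xi) (e l) = inner (ten l xi) w.
  rewrite op_sumE inner_suml (bigD1 l)//= inner_rank1 inner_bb eqxx mulr1 -adjP.
  by rewrite big1 ?addr0// => j /negPf jl; rewrite inner_rank1 inner_bb jl mulr0.
exists [seq al w | w <- W] => T; apply: op_ext_inner => x y.
rewrite big_map op_sumE inner_suml.
have TE u v : inner (T u) v =
    \sum_j \sum_l inner (T (e l)) (e j) * (inner u (e l) * inner (e j) v).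
  rewrite {1}(op_unit_decomp T) op_sumE inner_suml; apply: eq_bigr => j _.
  rewrite op_sumE inner_suml; apply: eq_bigr => l _.
  by rewrite opZE innerZl inner_rank1.
have -> : inner (Phi T x) y =
    \sum_j \sum_l inner (T (e l)) (e j) * inner (Phi (rank1 (e j) (e l)) x) y.
  rewrite {1}(op_unit_decomp T) linear_sum op_sumE inner_suml; apply: eq_bigr => j _.
  rewrite linear_sum op_sumE inner_suml; apply: eq_bigr => l _.
  by rewrite linearZ opZE innerZl.
rewrite (eq_bigr _ (fun w _ => etrans (compressE (al w) T x y) (TE _ _))).
rewrite [RHS]exchange_big /=; apply: eq_bigr => j _.
rewrite [RHS]exchange_big /=; apply: eq_bigr => l _.
rewrite -CU HW mulr_sumr; apply: eq_bigr => w _.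
by rewrite alE [inner (e j) _]innerC alE -innerC.
Qed.

(** Trace preservation in terms of Kraus operators: [sum a a^* = 1], read off at
    the matrix units. *)
Lemma kraus_trace (ks : seq H) :
  (forall T, \sum_s inner ((\sum_(a <- ks) compress a T) (e s)) (e s) =
    \sum_s inner (T (e s)) (e s)) ->
  forall l j, \sum_(a <- ks) \sum_s (a (e s) l : R[i]) * (a (e s) j : R[i])^* = (l == j)%:R.
Proof.
move=> tp l j; have := tp (rank1 (e j) (e l)).
rewrite [RHS](_ : _ = (l == j)%:R); last first.
  rewrite (bigD1 l)//= inner_rank1 inner_bb eqxx mul1r inner_bb eq_sym.
  rewrite big1 ?addr0// => s /negPf sl; by rewrite inner_rank1 inner_bb sl mul0r.
move=> <-; rewrite exchange_big /=; apply: eq_bigr => s _.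
rewrite op_sumE inner_suml; apply: eq_bigr => a _.
by rewrite compressE inner_rank1 inner_basis inner_basisl.
Qed.

(** [1 (x) a] maps [x (x) e_s] to [x (x) a e_s]. *)
Lemma ampl_ins (K : choiceType) (a : H) (s : 'I_n) (x : l2 R K) :
  ampl K a (ins R K s x) = \sum_l a (e s) l *: ins R K l x.
Proof.
apply: l2_ext => -[k i]; rewrite l2_sumE /=.
have -> : slice (ins_val s x) k = x k *: e s.
  apply: l2_ext => j; rewrite -[RHS]/(x k * (j == s)%:R) /=.
  by case: eqP => _; rewrite ?mulr1 ?mulr0.
rewrite linearZ (bigD1 i)//= -[LHS]/(x k * a (e s) i) -[X in _ = X + _]/(a (e s) i * _) /=.
rewrite eqxx mulrC big1 ?addr0// => l li.
by rewrite -[LHS]/(a (e s) l * _) /= eq_sym (negPf li) mulr0.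
Qed.

End kraus.

Section channel_majorized.
Variables (R : realType) (k n : nat) (n_gt0 : (0 < n)%N).
Notation H := (M R (Fin n_gt0) (Fin n_gt0)).

Lemma compress0 (I J : choiceType) (T : op R J J) : compress (0 : op R I J) T = 0.
Proof. by apply: op_ext_inner => x y; rewrite compressE op0E inner0r op0E inner0l. Qed.

Lemma ampl0 (K I J : choiceType) : ampl K (0 : op R I J) = 0.
Proof. by apply: op_ext => x; apply: l2_ext => -[k' j]. Qed.

(** Padding a finite list with zeros gives an eventually constant sequence of
    partial sums. *)
Lemma cvg_series_seq (I J L : choiceType) (ks : seq (op R I J))
    (f : op R I J -> op R L L) : f 0 = 0 ->
  series (fun i => f (nth 0 ks i)) @ \oo --> \sum_(a <- ks) f a.
Proof.
move=> f0; apply: cvg_near_cst; exists (size ks) => // N /= sN.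
rewrite /series /= (big_cat_nat (leq0n _) sN)/= [RHS](big_nth 0).
rewrite [X in _ + X](_ : _ = 0) ?addr0// big_nat_cond big1// => i.
by rewrite andbT => /andP[si _]; rewrite nth_default.
Qed.

Lemma channel_majorized (a b : 'I_k -> H) (Phi : {linear H -> H}) :
  trace_preserving Phi -> unital Phi -> completely_positive Phi ->
  (forall i, Phi (b i) = a i) -> nc_majorized a b.
Proof.
move=> tp un cp Pb p r F r0 aball bball [_ _ _ Fconv] _ [T FT <-].
have [ks HK] : exists ks : seq H, forall T, Phi T = \sum_(w <- ks) compress w T.
  exact: kraus cp.
pose S : MpM R p (Fin n_gt0) := \sum_(w <- ks) compress (id_tensor p w) T.
have gr : nc_graph r F (a, S).
  apply: (Fconv _ (fun=> Fin n_gt0) (fun=> b) (fun=> T) (fun i => nth 0 ks i)).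
  - by move=> i; split.
  - exists (Num.max (opnorm T) (\big[Num.max/0]_j opnorm (b j))) => i; split => [j|].
      by rewrite le_max; apply/orP; right; exact: le_bigmax.
    by rewrite le_max lexx.
  - have -> : idop R (idx (Fin n_gt0)) = \sum_(w <- ks) opcomp (adj w) w.
      have := HK (idop R 'I_n); rewrite un => ->.
      by apply: eq_bigr => w _; apply: op_ext.
    apply: (@cvg_series_seq _ _ _ ks (fun w => opcomp (adj w) w)).
    by apply: op_ext => x; rewrite opcompE op0E linear0.
  - move=> j; rewrite -Pb HK.
    by apply: (@cvg_series_seq _ _ _ ks (fun w => compress w (b j))); exact: compress0.
  - apply: (@cvg_series_seq _ _ _ ks (fun w => compress (id_tensor p w) T)).
    by rewrite /id_tensor ampl0 compress0.
have [_ FS] := gr.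
exists (ptrace S); first by exists S.
suff -> : ptrace S = ptrace T by move=> x; rewrite subrr op0E inner0l.
have nR : (n%:R : R[i]) != 0 by rewrite pnatr_eq0 -lt0n.
have kt := @kraus_trace R n ks.
have {}kt l j : \sum_(w <- ks) \sum_s (w (Defs.basis R s) l : R[i]) *
    (w (Defs.basis R s) j : R[i])^* = (l == j)%:R.
  apply: kt => X; apply: (mulfI (invr_neq0 nR)).
  by have := tp X; rewrite HK /tr.
apply: op_ext_inner => x y; rewrite !inner_ptrace; congr (_ * _).
have SE s : inner (S (ins R (idx p) s x)) (ins R (idx p) s y) = \sum_(w <- ks) \sum_j \sum_l
    ((w (Defs.basis R s) l : R[i]) * (w (Defs.basis R s) j : R[i])^*) *
    inner (T (ins R (idx p) l x)) (ins R (idx p) j y).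
  rewrite op_sumE inner_suml; apply: eq_bigr => w _.
  rewrite compressE !ampl_ins inner_sumr; apply: eq_bigr => j _.
  rewrite linear_sum inner_suml; apply: eq_bigr => l _.
  by rewrite linearZ innerZr innerZl; ring.
rewrite (eq_bigr _ (fun s _ => SE s)) exchange_big /=.
under eq_bigr do rewrite exchange_big /=.
rewrite exchange_big /=; apply: eq_bigr => j _.
under eq_bigr do rewrite exchange_big /=.
rewrite exchange_big /=.
rewrite (eq_bigr (fun l => (l == j)%:R * inner (T (ins R (idx p) l x)) (ins R (idx p) j y))).
  rewrite (bigD1 j)//= eqxx mul1r big1 ?addr0// => l /negPf lj.
  by rewrite lj mul0r.
move=> l _; rewrite -kt mulr_suml; apply: eq_bigr => w _.
by rewrite mulr_suml.
Qed.

End channel_majorized.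

Theorem corollary1p6 (R : realType) (k n : nat) (n_gt0 : (0 < n)%N)
    (a b : 'I_k -> M R (Fin n_gt0) (Fin n_gt0))
    (a_sa : forall i, selfadjoint (a i)) (b_sa : forall i, selfadjoint (b i)) :
  nc_majorized a b <->
  exists Phi : {linear M R (Fin n_gt0) (Fin n_gt0) -> M R (Fin n_gt0) (Fin n_gt0)},
    [/\ trace_preserving Phi, unital Phi, completely_positive Phi
      & forall i, Phi (b i) = a i].
Proof.
split; first exact: majorized_channel.
by move=> [Phi [tp un cp Pb]]; exact: (channel_majorized tp un cp Pb).
Qed.
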